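(* Let $m\ge 1$ be an integer and $\alpha>-1$ a real number with $\alpha-2m+1>0$. Let $u\in\mathcal{D}^{m,2}_{\infty}(\alpha)$ be a weak solution of $(-\Delta_\alpha)^m u=|u|^{2^*-2}u$ in $(0,\infty)$, that is, $$\int_0^\infty \nabla^m_\alpha u\,\nabla^m_\alpha v\, r^\alpha\,dr=\int_0^\infty |u|^{2^*-2}u\,v\,r^\alpha\,dr\qquad\text{for all } v\in \mathcal{D}^{m,2}_{\infty}(\alpha).$$ Then $u\in C^{2m}(0,\infty)$ and $u$ solves $(-\Delta_\alpha)^m u=|u|^{2^*-2}u$ in $(0,\infty)$ (pointwise). In addition, $u$ satisfies $$\lim_{r\to0}r^\alpha\Delta_\alpha^j u(r)=\lim_{r\to 0}r^\alpha(\Delta_\alpha^j u)'(r)=0\quad\text{for } j=0,1,\dots,m-1,$$ $$\lim_{r\to\infty}\Delta_\alpha^j u(r)=\lim_{r\to\infty}(\Delta_\alpha^j u)'(r)=0\quad\text{for } j=0,1,\dots,m,$$ and, for all $r>0$, $$(-\Delta_\alpha)^j u(r)=\int_r^\infty t^{-\alpha}\left(\int_0^t(-\Delta_\alpha)^{j+1}u(s)\,s^\alpha\,ds\right)dt\quad\text{for } j=0,1,\dots,m-1.$$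
   Context: For $q\ge1$ and $\theta>-1$, $L^q_\theta$ is the space of measurable $u:(0,\infty)\to\mathbb{R}$ with $\|u\|_{L^q_\theta}=(\int_0^\infty|u|^q r^\theta dr)^{1/q}<\infty$. $AC^{m-1}_{loc}(0,\infty)$ is the set of functions $u$ on $(0,\infty)$ having derivatives up to order $m-1$ with $u^{(m-1)}$ locally absolutely continuous. $\mathcal{D}^{m,2}_\infty(\alpha)$ is the completion of $\{u\in AC^{m-1}_{loc}(0,\infty): \lim_{r\to\infty}u^{(j)}(r)=0\ (0\le j\le m-1),\ u^{(m)}\in L^2_\alpha\}$ under the norm $\|u^{(m)}\|_{L^2_\alpha}$; since $\alpha-2m+1>0$, its elements are identified with functions in $AC^{m-1}_{loc}(0,\infty)$ with $u^{(j)}\in L^2_{\alpha-2(m-j)}$ for $0\le j\le m$. The $\alpha$-generalized radial Laplacian is $\Delta_\alpha u=r^{-\alpha}(r^\alpha u')'=u''+\frac{\alpha}{r}u'$, with iterates $\Delta_\alpha^j$ and $\Delta_\alpha^0 u=u$. Also $\nabla^m_\alpha u=\Delta^k_\alpha u$ if $m=2k$ and $\nabla^m_\alpha u=(\Delta^k_\alpha u)'$ if $m=2k+1$. The critical exponent is $2^*=\frac{2(\alpha+1)}{\alpha-2m+1}$, and $\mathcal{D}^{m,2}_\infty(\alpha)$ embeds continuously in $L^{2^*}_\alpha$. *)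

(* Defs.v *)
From HB Require Import structures.
From mathcomp Require Import all_boot all_order all_algebra.
From mathcomp Require Import all_classical all_reals all_analysis.

Set Implicit Arguments.
Unset Strict Implicit.
Unset Printing Implicit Defensive.

Import Order.TTheory GRing.Theory Num.Theory.
Import numFieldNormedType.Exports.

Local Open Scope ring_scope.
Local Open Scope classical_set_scope.

(* Functions on the half-line (0, oo) are represented by total functions
   R -> R whose values on (-oo, 0] are irrelevant: every notion below only
   involves the values at positive arguments. *)
Section Defs.
Context {R : realType}.
Implicit Types (u v w : R -> R) (alpha theta q r : R) (m k : nat).

Local Notation mu := (@lebesgue_measure R).

Definition wLnorm q theta u : \bar R :=
  poweR (\int[mu]_(r in `]0%R, +oo[) (`|u r| `^ q * r `^ theta)%:E)%E q^-1.

Definition in_wL q theta u : Prop :=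
  measurable_fun (`]0, +oo[ : set R) u /\ (wLnorm q theta u < +oo)%E.

Definition abs_continuous (a b : R) u : Prop :=
  forall e, 0 < e -> exists2 d, 0 < d &
    forall (n : nat) (x y : 'I_n -> R),
      (forall i, a <= x i /\ x i <= y i /\ y i <= b) ->
      trivIset setT (fun i => `]x i, y i[%classic) ->
      \sum_(i < n) (y i - x i) < d ->
      \sum_(i < n) `|u (y i) - u (x i)| < e.

Definition loc_abs_continuous u : Prop :=
  forall a b, 0 < a -> a <= b -> abs_continuous a b u.

Definition ACloc k u : Prop :=
  (forall j r, (j < k)%N -> 0 < r -> derivable (derive1n j u) r 1) /\
  loc_abs_continuous (derive1n k u).

(* If [ACloc m.-1 u] with [0 < m], then [derive1n m u] is the almost everywhere
   derivative of [derive1n m.-1 u]; at the exceptional points it takes the default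
   value of [derive1], which no integral sees. *)
Definition preD m alpha u : Prop :=
  [/\ ACloc m.-1 u,
      (forall j, (j < m)%N -> derive1n j u r @[r --> +oo] --> 0) &
      in_wL 2 alpha (derive1n m u)].

(* Completion of [preD] for the norm of u^(m) in L^2_alpha, with its elements
   identified with functions u in AC^{m-1}_loc such that
   u^(j) is in L^2_{alpha-2(m-j)}: the membership of the derivatives of order
   < m excludes nonzero polynomials of degree < m, on which the norm vanishes,
   so that the class of a Cauchy sequence determines u. *)
Definition inD m alpha u : Prop :=
  [/\ ACloc m.-1 u,
      (forall j, (j <= m)%N ->
        in_wL 2 (alpha - 2 * (m%:R - j%:R)) (derive1n j u)) &
      exists2 un : nat -> R -> R, (forall n, preD m alpha (un n)) &
        wLnorm 2 alpha (derive1n m (fun r => un n r - u r)) @[n --> \oo]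
          --> (0 : \bar R)].

Definition laplacian alpha w : R -> R :=
  fun r => r `^ (- alpha) * derive1 (fun s => s `^ alpha * derive1 w s) r.

Definition laplacian_iter alpha k w : R -> R := iter k (laplacian alpha) w.

Definition opp_laplacian_iter alpha k w : R -> R :=
  iter k (fun f r => - laplacian alpha f r) w.

Definition nabla alpha m u : R -> R :=
  if odd m then derive1 (laplacian_iter alpha m./2 u)
  else laplacian_iter alpha m./2 u.

Definition crit_exp m alpha : R := 2 * (alpha + 1) / (alpha - 2 * m%:R + 1).

Definition crit_nonlin m alpha u : R -> R :=
  fun r => `|u r| `^ (crit_exp m alpha - 2) * u r.

Definition weak_solution m alpha u : Prop :=
  forall v, inD m alpha v ->
    (\int[mu]_(r in `]0%R, +oo[)
        (nabla alpha m u r * nabla alpha m v r * r `^ alpha)%:E =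
     \int[mu]_(r in `]0%R, +oo[)
        (crit_nonlin m alpha u r * v r * r `^ alpha)%:E)%E.

Definition Ck_pos k u : Prop :=
  (forall j r, (j < k)%N -> 0 < r -> derivable (derive1n j u) r 1) /\
  (forall r, 0 < r -> {for r, continuous (derive1n k u)}).

End Defs.

(* Main.v *)
Require Import Defs.
From HB Require Import structures.
From mathcomp Require Import all_boot all_order all_algebra.
From mathcomp Require Import all_classical all_reals all_analysis.
From mathcomp Require Import measurable_realfun.
From mathcomp Require Import ring lra.

Set Implicit Arguments.
Unset Strict Implicit.
Unset Printing Implicit Defensive.

Import Order.TTheory GRing.Theory Num.Theory.
Import numFieldNormedType.Exports.

Local Open Scope ring_scope.
Local Open Scope classical_set_scope.

(**
  Put [b = (alpha - 2 m + 1) / 2 > 0], so that [alpha = 2 b + 2 m - 1], and let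
  [f = |u|^(2^* - 2) u].  Everything is measured on the scale of powers of
  [r], and [r^(-b)] is the critical scale: it is the one left invariant by the
  energy and by the nonlinearity.

  A function of finite energy is [O(r^(-b))].  Indeed [u^(j)^2 r^(2(b+j))] has an
  integrable derivative, because [u^(j)] and [u^(j+1)] are square integrable
  for the two neighbouring weights ([weighted_square_bound]); hence
  [u^(j) = O(r^(-b-j))] for [j < m], and [f = O(r^(-b-2m))] on the whole half-line
  ([inD_weak_symbol], [cont_symbol_crit_nonlin]).

  The operator [T h (r) = int_r^oo t^(-alpha) int_0^t h s^alpha ds dt] inverts
  [- Delta_alpha].  It sends [O(r^g)] to [O(r^(g+2))], with the same gain on all
  derivatives, as soon as [- (alpha + 1) < g < -2] ([symbol_radial_inv]).  The
  exponents [-b-2m, -b-2m+2, ..., -b-2] all lie in this window, so [w = T^m f] is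
  defined, of class C^(2m), with [w^(j) = O(r^(-b-j))] for [j <= 2m].  All the
  conclusions hold for [w]: they are the bounds of [w], the equation
  [(- Delta_alpha)^j w = T^(m-j) f], and the definition of [T].

  It remains to see that [u = w].  The weak equation is tested with
  [v = T^m phi], where [phi] is continuous and both [O(r^(-b-2m+e))] and
  [O(r^(-b-2m-e))]; then [v] is slightly better than the critical scale at 0 and
  at infinity, which makes it an admissible test function ([symbol_inD]) and
  makes every boundary term vanish ([integration_by_parts_pos]).  Moving the
  derivatives one at a time gives
    [int u phi r^alpha = int f v r^alpha = int w phi r^alpha],
  first by the weak equation ([energy_test]), then because [T^m] is symmetric
  ([dual_test]).  The choice [phi = (u - w) r^(-2m) / (r^e + r^(-e))] makes the
  difference of the two ends the integral of a nonnegative continuous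
  function, so [u = w] ([solution_representation]).

  The integration by parts that involves [u^(m)] needs the fundamental theorem
  of calculus for absolutely continuous functions ([abs_continuous_FTC]): such
  a function is a difference of monotone ones whose Stieltjes measures are
  dominated by the Lebesgue measure, and one takes their Radon-Nikodym
  densities.
*)

(** * Derivatives of functions on the half-line *)

Section HasDeriv.
Context {R : realType}.
Implicit Types (f g : R -> R) (x c d : R).

(** The derivative is kept together with derivability, so that a derivative is
    computed by composing the lemmas below, without rewriting. *)
Definition has_deriv f x d := derivable f x 1 /\ derive1 f x = d.

Lemma has_deriv_is f x d : is_derive x 1 f d -> has_deriv f x d.
Proof. by move=> h; split; [exact: ex_derive|rewrite derive1E derive_val]. Qed.

Lemma is_has_deriv f x d : has_deriv f x d -> is_derive x 1 f d.
Proof. by move=> [h1 <-]; rewrite derive1E; exact: derivableP. Qed.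

Lemma has_deriv_eq f x d d' : has_deriv f x d -> d = d' -> has_deriv f x d'.
Proof. by move=> h <-. Qed.

Lemma has_derivD f g x d d' : has_deriv f x d -> has_deriv g x d' ->
  has_deriv (fun y => f y + g y) x (d + d').
Proof. by move=> /is_has_deriv hf /is_has_deriv hg; apply: has_deriv_is. Qed.

Lemma has_derivM f g x d d' : has_deriv f x d -> has_deriv g x d' ->
  has_deriv (fun y => f y * g y) x (d * g x + f x * d').
Proof.
move=> /is_has_deriv hf /is_has_deriv hg; apply: has_deriv_is.
have h := is_deriveM hf hg.
rewrite [d * _]mulrC addrC; exact: h.
Qed.

Lemma has_deriv_cst c x : has_deriv (fun=> c) x 0.
Proof. by apply: has_deriv_is; exact: is_derive_cst. Qed.

Lemma has_derivZ c f x d : has_deriv f x d -> has_deriv (fun y => c * f y) x (c * d).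
Proof.
move=> h; apply: has_deriv_eq (has_derivM (has_deriv_cst c x) h) _.
by rewrite mul0r add0r.
Qed.

Lemma has_derivN f x d : has_deriv f x d -> has_deriv (fun y => - f y) x (- d).
Proof.
by move=> /is_has_deriv h; apply: has_deriv_is; exact: (is_deriveN h).
Qed.

Lemma has_derivB f g x d d' : has_deriv f x d -> has_deriv g x d' ->
  has_deriv (fun y => f y - g y) x (d - d').
Proof. by move=> h1 h2; apply: has_derivD => //; exact: has_derivN. Qed.

Lemma has_deriv_powR (a x : R) : 0 < x ->
  has_deriv (fun y => y `^ a) x (a * x `^ (a - 1)).
Proof.
move=> x0; apply: has_deriv_is; exact: is_derive1_powR.
Qed.

Lemma has_deriv_comp f g x d d' : has_deriv f x d -> has_deriv g (f x) d' ->
  has_deriv (fun y => g (f y)) x (d' * d).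
Proof. by move=> /is_has_deriv h1 /is_has_deriv h2; apply: has_deriv_is. Qed.

Lemma has_deriv_continuous f x d : has_deriv f x d -> {for x, continuous f}.
Proof. by move=> [h _]; apply: differentiable_continuous; exact/derivable1_diffP. Qed.

Lemma near_pos x : 0 < x -> \forall y \near x, 0 < y.
Proof. by move=> x0; exact: lt_nbhsr. Qed.

Lemma has_deriv_near f g x d : {near x, f =1 g} -> has_deriv f x d -> has_deriv g x d.
Proof.
move=> fg [h1 h2]; split; first by apply: near_eq_derivable fg h1; rewrite oner_eq0.
by rewrite -h2 !derive1E; apply/esym/near_eq_derive => //; rewrite oner_eq0.
Qed.

Lemma near_eq_pos f g x : 0 < x -> (forall y, 0 < y -> f y = g y) -> {near x, f =1 g}.
Proof. by move=> x0 fg; apply: filterS (near_pos x0) => y; exact: fg. Qed.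

Lemma has_deriv_pos f g x d : 0 < x -> (forall y, 0 < y -> f y = g y) ->
  has_deriv f x d -> has_deriv g x d.
Proof. by move=> x0 fg; apply: has_deriv_near; exact: near_eq_pos. Qed.

Lemma continuous_pos f g x : 0 < x -> (forall y, 0 < y -> f y = g y) ->
  {for x, continuous f} -> {for x, continuous g}.
Proof.
move=> x0 fg; rewrite /prop_for /continuous_at -fg// => h.
by apply: cvg_trans h; apply: near_eq_cvg; exact: near_eq_pos.
Qed.

(** Derivatives are compared through [lim], so that the equality also holds at
    the points where the functions have no derivative. *)
Lemma eq_derive1_pos f g x : 0 < x -> (forall y, 0 < y -> f y = g y) ->
  derive1 f x = derive1 g x.
Proof.
move=> x0 fg; rewrite !derive1E; apply: near_eq_derive => //; exact: near_eq_pos.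
Qed.

Lemma continuous_powR (a x : R) : 0 < x -> {for x, continuous (fun y => y `^ a)}.
Proof. by move=> x0; apply: has_deriv_continuous; exact: has_deriv_powR. Qed.

End HasDeriv.

(** * Absolutely continuous functions: variation of interval families *)

Section NonOverlapping.
Context {R : realType}.
Implicit Types (p q : R * R) (s t : seq (R * R)) (f g : R -> R).

Definition sep p q := (p.2 <= q.1) || (q.2 <= p.1).

Definition nonoverlapping s := all (fun p => p.1 <= p.2) s && pairwise sep s.

Definition total_length s := \sum_(p <- s) (p.2 - p.1).

Definition oscillation f s := \sum_(p <- s) `|f p.2 - f p.1|.

(** Absolute continuity on the whole line, with families of intervals given as
    lists of pairs of end points: subdividing an interval of the family is then
    a concatenation. *)
Definition unif_abs_continuous f := forall e : R, 0 < e -> exists2 d : R, 0 < d &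
  forall s, nonoverlapping s -> total_length s < d -> oscillation f s < e.

Lemma sepC p q : sep p q = sep q p.
Proof. by rewrite /sep orbC. Qed.

(** Precomposition with [clamp a b] extends a function on [`[a, b]] by
    constants, keeping its modulus of absolute continuity. *)
Definition clamp (a b x : R) := Num.max a (Num.min x b).

Lemma clamp_id a b x : a <= x -> x <= b -> clamp a b x = x.
Proof. by move=> ax xb; rewrite /clamp (min_idPl xb) (max_idPr ax). Qed.

Lemma clamp_in a b x : a <= b -> a <= clamp a b x <= b.
Proof.
by move=> ab; rewrite /clamp le_max lexx/= ge_max ab/= ge_min lexx orbT.
Qed.

Lemma clamp_nd a b x y : x <= y -> clamp a b x <= clamp a b y.
Proof. by move=> xy; rewrite /clamp ge_max !le_max lexx/= le_min2// orbT. Qed.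

Lemma clamp_lip a b x y : a <= b -> x <= y ->
  clamp a b y - clamp a b x <= y - x.
Proof.
move=> ab xy; rewrite /clamp !maxEle !minEle.
by do ! case: ifPn; rewrite -?ltNge => *; lra.
Qed.

Lemma unif_abs_continuous_clamp a b f : a <= b -> abs_continuous a b f ->
  unif_abs_continuous (f \o clamp a b).
Proof.
move=> ab fac e /fac [d d0 fd]; exists d => // s /andP[s1 s2] sd.
pose z : R * R := (0, 0).
pose x (i : 'I_(size s)) := clamp a b (nth z s i).1.
pose y (i : 'I_(size s)) := clamp a b (nth z s i).2.
have xy (i : 'I_(size s)) : (nth z s i).1 <= (nth z s i).2.
  by apply: (allP s1); exact: mem_nth.
rewrite /oscillation (big_nth z) big_mkord; apply: (fd _ x y).
- move=> i; have /andP[? ?] := clamp_in (nth z s i).1 ab.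
  by have /andP[? ?] := clamp_in (nth z s i).2 ab; split=> //; split=> //;
    exact: clamp_nd.
- apply/trivIsetP => i j _ _ ij.
  wlog ltij : i j ij / (i < j)%N.
    move=> W; have [h|h|h] := ltngtP i j; [exact: W| |].
    - by rewrite setIC; apply: W => //; rewrite eq_sym.
    - by move: ij; rewrite -val_eqE /= h eqxx.
  have := (pairwiseP z s2) i j; rewrite !inE !ltn_ord => /(_ isT isT ltij).
  rewrite -subset0 => /orP[h|h] t /= [];
    rewrite !in_itv/= /x /y => /andP[t1 t2] /andP[t3 t4];
    have := clamp_nd a b h; lra.
- apply: le_lt_trans sd; rewrite /total_length (big_nth z) big_mkord.
  by apply: ler_sum => i _; exact: clamp_lip.
Qed.

Lemma path_pieces a l : path <%R a l ->
  [/\ nonoverlapping (zip (a :: l) l),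
      all (fun p => (a <= p.1) && (p.2 <= last a l)) (zip (a :: l) l),
      total_length (zip (a :: l) l) = last a l - a & a <= last a l].
Proof.
elim: l a => [|b l IH] a /=.
  by move=> _; rewrite /total_length big_nil subrr lexx.
move=> /andP[ab /IH[/andP[h1 h2] h3 h4 h5]].
have h3' : all (fun p => (a <= p.1) && (p.2 <= last b l)) (zip (b :: l) l).
  by apply: sub_all h3 => p /andP[h ->]; rewrite andbT (le_trans (ltW ab)).
split; rewrite ?lexx ?h5 ?h3'//.
- rewrite /nonoverlapping /= (ltW ab) h1 h2 /= andbT.
  by apply: sub_all h3 => p /andP[h _]; rewrite /sep /= h.
- by rewrite /total_length big_cons -/(total_length _) h4 /=; lra.
- exact: le_trans (ltW ab) h5.
Qed.

Lemma variation_oscillation a b f l : itv_partition a b l ->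
  variation a b f l = oscillation f (zip (a :: l) l).
Proof.
move=> abl; rewrite (variation_zip _ abl) /oscillation.
by elim: l {b abl} a => [|b l IH] a; rewrite /= ?big_nil// !big_cons IH.
Qed.

Lemma sep_sub p q t :
  all (fun r => (p.1 <= r.1) && (r.2 <= p.2)) t -> sep p q -> all (sep q) t.
Proof.
move=> tp pq; apply: sub_all tp => r /andP[r1 r2].
by move: pq; rewrite /sep => /orP[h|h]; apply/orP;
  [right; exact: le_trans h|left; exact: le_trans r1].
Qed.

Lemma oscillation_ge0 f s : 0 <= oscillation f s.
Proof. by apply: sumr_ge0 => p _; exact: normr_ge0. Qed.

(** Subdividing the intervals of a family does not change their total length, so
    the bound on the oscillation passes to the supremum over subdivisions. *)
Lemma sum_total_variation_le f (e d : R) : 0 < e ->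
  (forall s, nonoverlapping s -> total_length s < d -> oscillation f s < e) ->
  forall s, nonoverlapping s -> total_length s < d ->
  (\sum_(p <- s) total_variation p.1 p.2 f <= e%:E)%E.
Proof.
move=> e0 fd s ns sd.
(* the intervals of [s] count with their variation, those of [t] with their
   oscillation; subdividing an interval of [s] moves it to [t] *)
suff H t : nonoverlapping (s ++ t) -> total_length (s ++ t) < d ->
    (\sum_(p <- s) total_variation p.1 p.2 f + (oscillation f t)%:E <= e%:E)%E.
  have := H [::]; rewrite cats0 => /(_ ns sd).
  by rewrite /oscillation big_nil adde0.
elim: s t {ns sd} => [|p s IH] t.
  by move=> nt td; rewrite big_nil add0e lee_fin ltW// fd.
rewrite /= => /andP[/= /andP[p12 st1] /andP[pst st2]] std.
have TV0 q : q \in s -> (0%E <= total_variation q.1 q.2 f)%E.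
  by move=> qs; apply: total_variation_ge0; apply: (allP st1); rewrite mem_cat qs.
have {}IH l : itv_partition p.1 p.2 l ->
    (\sum_(q <- s) total_variation q.1 q.2 f +
     ((variation p.1 p.2 f l)%:E + (oscillation f t)%:E) <= e%:E)%E.
  move=> pl; have [pl1 /eqP pl2] := pl.
  have [/andP[h1 h2] h3 h4 _] := path_pieces pl1; rewrite pl2 in h3 h4.
  have := IH (zip (p.1 :: l) l ++ t).
  have -> : oscillation f (zip (p.1 :: l) l ++ t) =
      oscillation f (zip (p.1 :: l) l) + oscillation f t.
    by rewrite /oscillation big_cat.
  rewrite EFinD -(variation_oscillation f pl); apply.
  - move: st1 st2 pst; rewrite /nonoverlapping !all_cat !pairwise_cat.
    move=> /andP[-> ->] /and3P[st -> ->] /andP[ps pt]; rewrite h1 h2 !andbT/=.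
    rewrite allrel_catr st andbT /allrel; apply/andP; split.
    + apply/allP => q qs; apply: (sep_sub h3); exact: (allP ps).
    + apply/allP => q qz; apply/allP => r rt; rewrite sepC.
      by apply: (allP (sep_sub h3 ((allP pt) _ rt))).
  - move: std h4; rewrite /total_length !big_cat/= big_cons big_cat/=.
    by move=> std h4; lra.
rewrite big_cons addeAC addeC.
have [/eqP|] := boolP (p.1 == p.2).
  move=> pE; rewrite -[in total_variation _ _ _]pE total_variationxx add0e.
  have /IH : itv_partition p.1 p.2 [::] by split => //=; exact/eqP.
  by rewrite variation_nil add0e.
move=> pN; have plt : p.1 < p.2 by rewrite lt_neqAle pN.
have Sfin : (\sum_(q <- s) total_variation q.1 q.2 f)%E \is a fin_num.
  have := IH _ (itv_partition1 plt).
  have S0 : (0 <= \sum_(q <- s) total_variation q.1 q.2 f)%E.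
    by rewrite big_seq; apply: sume_ge0 => q qs; exact: TV0.
  rewrite ge0_fin_numE// -EFinD => h; apply: le_lt_trans (ltry e).
  by apply: le_trans h; rewrite leeDl// lee_fin addr_ge0 ?oscillation_ge0// variation_ge0.
rewrite addeCA -leeBrDr ?fin_numD ?Sfin//.
apply: ge_ereal_sup => _ [_ [l pl <-] <-].
by rewrite leeBrDr ?fin_numD ?Sfin// addeCA; exact: IH.
Qed.

End NonOverlapping.

Section Jordan.
Context {R : realType}.
Implicit Types (f g G : R -> R) (s : seq (R * R)).

Lemma unif_abs_continuous_TV_lt g a b : unif_abs_continuous g -> a <= b ->
  (total_variation a b g < +oo)%E.
Proof.
move=> gac ab; have [d d0 gd] := gac 1 ltr01.
have step x y : x <= y -> y - x < d -> (total_variation x y g <= 1%E)%E.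
  move=> xy xyd; have := sum_total_variation_le ltr01 gd (s := [:: (x, y)]).
  rewrite big_seq1; apply; last by rewrite /total_length big_seq1.
  by rewrite /nonoverlapping/= xy.
have H n : (total_variation a (a + n%:R * (d / 2)) g <= n%:R%:E)%E.
  elim: n => [|n IH]; first by rewrite mul0r addr0 total_variationxx.
  have d20 : 0 < d / 2 by lra.
  have an : a <= a + n%:R * (d / 2) by rewrite lerDl mulr_ge0 ?ler0n// ltW.
  rewrite -natr1 mulrDl mul1r addrA.
  rewrite (@total_variationD _ _ _ (a + n%:R * (d / 2))) ?lerDl ?(ltW d20)//;
    last by rewrite mulr_ge0 ?ler0n ?ltW.
  by rewrite EFinD leeD// step ?lerDl ?(ltW d20)// [ltLHS]addrAC subrr add0r; lra.
have [k bk] : exists n : nat, b <= a + n%:R * (d / 2).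
  exists (Num.bound ((b - a) / (d / 2))); rewrite -lerBlDl.
  rewrite -ler_pdivrMr ?divr_gt0//; apply/ltW.
  have: 0 <= (b - a) / (d / 2) by rewrite divr_ge0 ?subr_ge0// ltW// divr_gt0.
  by move/archi_boundP.
apply: (@le_lt_trans _ _ k%:R%:E); last exact: ltry.
apply: le_trans (H k).
by rewrite (total_variationD g ab bk) leeDl// total_variation_ge0.
Qed.

Lemma clampK a b (x : R) : a <= b -> clamp a b (clamp a b x) = clamp a b x.
Proof. by move=> ab; have /andP[? ?] := clamp_in x ab; rewrite clamp_id. Qed.

(** The Jordan decomposition, by [sum_total_variation_le]: the variation of an
    absolutely continuous function is again absolutely continuous. *)
Lemma unif_abs_continuous_jordan a b f : a <= b -> abs_continuous a b f ->
  exists2 GH : (R -> R) * (R -> R),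
    [/\ {homo GH.1 : x y / x <= y}, {homo GH.2 : x y / x <= y},
        unif_abs_continuous GH.1 & unif_abs_continuous GH.2] &
    forall x, f (clamp a b x) = GH.1 x - GH.2 x.
Proof.
move=> ab /(unif_abs_continuous_clamp ab); set g := f \o clamp a b => gac.
pose c := clamp a b.
pose V x := fine (total_variation a (c x) g).
have cin x : a <= c x <= b by exact: clamp_in.
have TVE x y : x <= y -> (V y - V x)%:E = total_variation (c x) (c y) g.
  move=> xy; have /andP[ax _] := cin x; have /andP[ay _] := cin y.
  have fx := unif_abs_continuous_TV_lt gac ax.
  have fy := unif_abs_continuous_TV_lt gac ay.
  rewrite EFinB !fineK ?ge0_fin_numE ?total_variation_ge0//.
  rewrite (total_variationD g ax (clamp_nd a b xy)).
  rewrite [X in (X - _)%E]addeC addeK//.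
  by rewrite ge0_fin_numE ?total_variation_ge0.
have Vnd x y : x <= y -> 0 <= V y - V x.
  move=> xy; rewrite -lee_fin TVE//; apply: total_variation_ge0.
  exact: clamp_nd.
have gV x y : x <= y -> `|g y - g x| <= V y - V x.
  move=> xy; rewrite -lee_fin TVE//.
  have -> : `|g y - g x| = `|g (c y) - g (c x)|.
    by rewrite /g /= /c !clampK.
  by apply: total_variation_ge; exact: clamp_nd.
have Vac : unif_abs_continuous V.
  move=> e e0; have e20 : 0 < e / 2 by lra.
  have [d d0 gd] := gac _ e20; exists d => // s /andP[s1 s2] sd.
  pose s' := [seq (c p.1, c p.2) | p <- s].
  have ns' : nonoverlapping s'.
    rewrite /nonoverlapping all_map pairwise_map; apply/andP; split.
      by apply: sub_all s1 => p; exact: clamp_nd.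
    apply: sub_pairwise s2 => p q /orP[h|h]; apply/orP;
      by [left; exact: clamp_nd|right; exact: clamp_nd].
  have sd' : total_length s' < d.
    apply: le_lt_trans sd; rewrite /total_length big_map big_seq [leRHS]big_seq.
    by apply: ler_sum => p ps; apply: clamp_lip => //; exact: (allP s1).
  have := sum_total_variation_le e20 gd ns' sd'.
  suff -> : (\sum_(p <- s') total_variation p.1 p.2 g = (oscillation V s)%:E)%E.
    by rewrite lee_fin => /le_lt_trans; apply; lra.
  rewrite /oscillation big_map -sumEFin big_seq [RHS]big_seq.
  apply: eq_bigr => p ps; have p12 := allP s1 _ ps.
  by rewrite -TVE// ger0_norm// Vnd.
exists (V, fun x => V x - g x) => /=; last by move=> x; rewrite /g/=; ring.
split => //.
- by move=> x y /Vnd; rewrite subr_ge0.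
- move=> x y xy; have := le_trans (ler_norm _) (gV _ _ xy); lra.
- move=> e e0; have e20 : 0 < e / 2 by lra.
  have [d1 d10 h1] := Vac _ e20; have [d2 d20 h2] := gac _ e20.
  exists (Num.min d1 d2); first by rewrite lt_min d10.
  move=> s ns; rewrite lt_min => /andP[/(h1 _ ns) o1 /(h2 _ ns) o2].
  apply: (@le_lt_trans _ _ (oscillation V s + oscillation g s)); last lra.
  rewrite /oscillation -big_split; apply: ler_sum => p _ /=.
  rewrite [X in `|X|](_ : _ = V p.2 - V p.1 - (g p.2 - g p.1)); last ring.
  exact: ler_normB.
Qed.

End Jordan.

Section Monotone.
Context {R : realType}.
Notation mu := (@lebesgue_measure R).
Implicit Types (f g G : R -> R) (s : seq (R * R)).

Lemma unif_abs_continuous_cts G : unif_abs_continuous G -> continuous G.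
Proof.
move=> Gac x; apply/cvgrPdist_lt => e /Gac [d d0 Gd].
near=> y; have xyd : `|x - y| < d.
  by near: y; apply: cvgr_dist_lt => //; exact: cvg_id.
have [xy|/ltW yx] := leP x y.
- have := Gd [:: (x, y)]; rewrite /nonoverlapping/= xy /oscillation /total_length.
  rewrite !big_seq1/= distrC; apply=> //.
  by move: xyd; rewrite distrC ger0_norm// subr_ge0.
- have := Gd [:: (y, x)]; rewrite /nonoverlapping/= yx /oscillation /total_length.
  rewrite !big_seq1/=; apply=> //.
  by move: xyd; rewrite ger0_norm// subr_ge0.
Unshelve. all: by end_near. Qed.

Variable G : R -> R.
Hypotheses (Gnd : {homo G : x y / x <= y}) (Gac : unif_abs_continuous G).

Let Grc : right_continuous G.
Proof. exact/right_continuousW/unif_abs_continuous_cts. Qed.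

#[local]
HB.instance Definition _ := isCumulative.Build R _ R G Gnd Grc.

Let nu : {measure set (measurableTypeR R) -> \bar R} :=
  lebesgue_stieltjes_measure (G : cumulative R R).

Lemma stieltjes_oc x y : x <= y -> nu `]x, y] = (G y - G x)%:E.
Proof.
move=> xy; rewrite /nu/= /lebesgue_stieltjes_measure /measure_extension.
rewrite measurable_mu_extE/=; last exact: is_ocitv.
by rewrite wlength_itv_bnd.
Qed.

Lemma disjoint_itv_sep (x y x' y' : R) : x < y -> x' < y' ->
  `]x, y[%classic `&` `]x', y'[%classic = set0 -> sep (x, y) (x', y').
Proof.
move=> xy xy' /seteqP[d0 _]; rewrite /sep/=; apply/negPn/negP.
rewrite negb_or -!ltNge => /andP[h1 h2].
pose l := Num.max x x'; pose r := Num.min y y'.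
have lr : l < r by rewrite /l /r gt_max !lt_min xy xy' h1 h2.
have [lx lx'] : x <= l /\ x' <= l by rewrite /l !le_max !lexx orbT.
have [ry ry'] : r <= y /\ r <= y' by rewrite /r !ge_min !lexx orbT.
have := d0 ((l + r) / 2); apply; split; rewrite /= in_itv/=; apply/andP; lra.
Qed.

Lemma open_bounded_interval (I : set R) (l r : R) : open I -> is_interval I ->
  I `<=` `]l, r[%classic -> I = `]inf I, sup I[%classic.
Proof.
move=> oI iI Ilr; have : I = I^°.
  by apply/seteqP; split; [rewrite -open_subsetE|exact: interior_subset].
have lI : has_lbound I by exists l => x /Ilr; rewrite /= in_itv/= => /andP[/ltW].
have uI : has_ubound I by exists r => x /Ilr; rewrite /= in_itv/= => /andP[_ /ltW].
rewrite (interval_bounded_interior iI lI uI) => IE.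
by rewrite [LHS]IE; apply/seteqP; split => x /=; rewrite in_itv.
Qed.

(** An open set is a countable disjoint union of open intervals, and absolute
    continuity bounds the increments of [G] over finitely many of them. *)
Lemma stieltjes_open (e d l r : R) (U : set R) : open U ->
  U `<=` `]l, r[%classic ->
  (forall s, nonoverlapping s -> total_length s < d -> oscillation G s < e) ->
  (mu U < d%:E)%E -> (nu U <= e%:E)%E.
Proof.
move=> oU Ulr Gd Ud.
pose I := open_disjoint_itv oU.
have oI k : open (I k) := @open_disjoint_itv_open _ _ oU k.
have UE : U = \bigcup_k I k := @open_disjoint_itv_bigcup _ _ oU.
have IU k : I k `<=` U by rewrite UE; exact: bigcup_sup.
have IE k : I k = `]inf (I k), sup (I k)[%classic.
  apply: (open_bounded_interval (oI k) (@open_disjoint_itv_is_interval _ _ oU k)).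
  exact: subset_trans (IU k) Ulr.
have tI : trivIset setT I := @open_disjoint_itv_trivIset _ _ oU.
have mI k : measurable (I k) by exact: open_measurable.
have mU : measurable U by exact: open_measurable.
have inf_lt_sup k : I k != set0 -> inf (I k) < sup (I k).
  by move=> /set0P[x]; rewrite {1}IE/= in_itv/= => /andP[]; exact: lt_trans.
have nuU : nu U = (\sum_(k <oo) nu (I k))%E.
  by rewrite [in LHS]UE measure_semi_bigcup// -UE.
have muU : mu U = (\sum_(k <oo) mu (I k))%E.
  by rewrite [in LHS]UE measure_semi_bigcup// -UE.
rewrite nuU; apply: lime_le; first exact: is_cvg_nneseries.
apply: nearW => n.
pose J := [seq k <- index_iota 0 n | I k != set0].
pose s := [seq (inf (I k), sup (I k)) | k <- J].
have ns : nonoverlapping s.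
  rewrite /nonoverlapping all_map pairwise_map; apply/andP; split.
    by apply/allP => k; rewrite mem_filter => /andP[/inf_lt_sup/ltW].
  apply: (@sub_in_pairwise _ [pred k | I k != set0] [rel x y | x != y]).
  - move=> i j /= i0 j0 ij.
    apply: disjoint_itv_sep; [exact: inf_lt_sup|exact: inf_lt_sup|].
    by rewrite -!IE; move/trivIsetP : tI; exact.
  - exact: filter_all.
  - by rewrite -uniq_pairwise filter_uniq// iota_uniq.
have sumJ (m : {measure set (measurableTypeR R) -> \bar R}) :
    (\sum_(0 <= k < n) m (I k) = \sum_(k <- J) m (I k))%E.
  rewrite /J big_filter [in RHS]big_mkcond/=; apply: eq_bigr => k _.
  by case: eqP => // ->; rewrite measure0.
have sd : total_length s < d.
  rewrite -lte_fin; apply: le_lt_trans Ud.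
  rewrite muU; apply: (le_trans _ (nneseries_lim_ge n _)) => //.
  rewrite (sumJ mu) /total_length big_map -sumEFin big_seq [leRHS]big_seq.
  apply: lee_sum => k; rewrite mem_filter => /andP[/inf_lt_sup k0 _] /=.
  by rewrite [in leRHS]IE lebesgue_measure_itv/= lte_fin k0.
rewrite (sumJ nu); apply: le_trans (ltW _ : (oscillation G s)%:E <= e%:E)%E.
  rewrite /oscillation big_map -sumEFin big_seq [leRHS]big_seq.
  apply: lee_sum => k; rewrite mem_filter => /andP[/inf_lt_sup/ltW k0 _] /=.
  rewrite ger0_norm ?subr_ge0 ?Gnd//.
  rewrite -stieltjes_oc// [in leLHS]IE; apply: le_measure; rewrite ?inE//.
  by apply: subset_itvl; rewrite bnd_simp.
by rewrite lte_fin; exact: Gd.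
Qed.

Variables (a b : R).
Hypothesis ab : a <= b.

Let mab : measurable (`]a, b]%classic : set (measurableTypeR R)).
Proof. exact: measurable_itv. Qed.

Let nuab : (nu `]a, b] < +oo)%E.
Proof. by rewrite stieltjes_oc// ltry. Qed.

Let nu' : {finite_measure set (measurableTypeR R) -> \bar R} := mfrestr mab nuab.

(** A null set has open neighbourhoods of small Lebesgue measure, which have
    small Stieltjes measure. *)
Lemma stieltjes_dominated : nu' `<< (mu : set (measurableTypeR R) -> \bar R).
Proof.
move=> N0 Nnull A mA AN0.
have A0 : mu A = 0%E by exact: Nnull.
rewrite /nu'/= /mfrestr /mrestr; set B := A `&` `]a, b].
have mB : measurable B by exact: measurableI.
have B0 : mu B = 0%E by apply: (subset_measure0 _ _ _ A0) => //; exact: subIsetl.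
apply/eqP; rewrite -measure_le0; apply/lee_addgt0Pr => e e0; rewrite add0e.
have [d d0 Gd] := Gac e0.
have Bfin : (mu B < +oo)%E by rewrite B0 ltry.
have [U [oU BU UB]] := lebesgue_regularity_outer mB Bfin d0.
(* a bounded neighbourhood: the end points of its components are real *)
pose W := U `&` `](a - 1), (b + 1)[%classic.
have oW : open W by apply: openI => //; exact: interval_open.
have BW : B `<=` W.
  move=> x Bx; split; first exact: BU.
  by case: Bx => _; rewrite /= !in_itv/= => /andP[h1 h2]; apply/andP; lra.
have mW : measurable W by exact: open_measurable.
apply: (@le_trans _ _ (nu W)); first by rewrite le_measure ?inE.
apply: (stieltjes_open oW _ Gd); first exact: subIsetr.
apply: le_lt_trans UB.
have mU : measurable U by exact: open_measurable.
have muUE : mu U = (mu (U `\` B))%E.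
  by rewrite -[in LHS](setDKU BU) measureU0//; exact: measurableD.
apply: (@le_trans _ _ (mu U)); first by rewrite le_measure ?inE//; exact: subIsetl.
by move/eqP: muUE; rewrite eq_le => /andP[].
Qed.

Lemma monotone_ac_density : exists2 g : R -> R,
  mu.-integrable setT (EFin \o g) &
  forall x, a <= x -> x <= b ->
    (\int[mu]_(t in `]a, x]) (g t)%:E = (G x - G a)%:E)%E.
Proof.
have nm := stieltjes_dominated.
pose g := Radon_Nikodym_SigmaFinite.f nu' mu.
have gfin := Radon_Nikodym_SigmaFinite.f_fin_num nm.
have gE : EFin \o (fine \o g) = g by apply/funext => x /=; rewrite fineK.
exists (fine \o g).
  by rewrite gE; exact: Radon_Nikodym_SigmaFinite.f_integrable.
move=> x ax xb; rewrite -stieltjes_oc//.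
transitivity (nu' `]a, x]).
  rewrite (@Radon_Nikodym_SigmaFinite.f_integral _ _ _ nu' mu nm)//.
  by apply: eq_integral => y _ /=; rewrite fineK.
rewrite /nu'/= /mfrestr /mrestr setIidl//.
by apply: subset_itvl; rewrite bnd_simp.
Qed.

End Monotone.

(** * Absolutely continuous functions: the fundamental theorem of calculus *)

Section FTC.
Context {R : realType}.
Notation mu := (@lebesgue_measure R).
Implicit Types (f g F G : R -> R) (a b x : R).

Lemma near_itvoo a b x : a < x < b -> \forall y \near x, a < y < b.
Proof.
move=> axb; have : x \in Interval (BRight a) (BLeft b) by rewrite in_itv.
by move=> /near_in_itvoo; apply: filterS => y; rewrite in_itv.
Qed.

Lemma eq_on_derive1 f g a b x : a < x < b ->
  (forall y, a < y < b -> f y = g y) -> derivable f x 1 ->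
  derivable g x 1 /\ derive1 g x = derive1 f x.
Proof.
move=> axb fg df.
have fgn : {near x, f =1 g} by near=> y; apply: fg; near: y; exact: near_itvoo.
split; first by apply: near_eq_derivable fgn df; rewrite oner_eq0.
by rewrite !derive1E; apply/esym/near_eq_derive => //; rewrite oner_eq0.
Unshelve. all: by end_near. Qed.

(** The density is the difference of the Radon-Nikodym densities of the two
    monotone parts; the almost everywhere derivative comes from Lebesgue's
    differentiation theorem for the integral of that density. *)
Lemma abs_continuous_FTC a b F : a <= b -> abs_continuous a b F ->
  exists g, [/\ mu.-integrable setT (EFin \o g),
    (forall x, a <= x <= b ->
      (\int[mu]_(t in `]a, x]) (g t)%:E = (F x - F a)%:E)%E) &
    {ae mu, forall x, a < x < b -> derivable F x 1 /\ derive1 F x = g x}].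
Proof.
move=> ab Fac.
have [[G H] /= [Gnd Hnd Gac Hac] FE] := unif_abs_continuous_jordan ab Fac.
have [g1 ig1 g1E] := monotone_ac_density Gnd Gac ab.
have [g2 ig2 g2E] := monotone_ac_density Hnd Hac ab.
pose g x := g1 x - g2 x.
have ig : mu.-integrable setT (EFin \o g).
  rewrite (_ : EFin \o g = (EFin \o g1) \- (EFin \o g2))%E; last exact/funext.
  exact: integrableB.
have gE x : a <= x <= b -> (\int[mu]_(t in `]a, x]) (g t)%:E = (F x - F a)%:E)%E.
  move=> /andP[ax xb].
  have {1}-> : F x = G x - H x by rewrite -FE clamp_id.
  have -> : F a = G a - H a by rewrite -FE clamp_id.
  under eq_integral do rewrite EFinB.
  rewrite integralB_EFin//; last 2 first.
  - by apply: integrableS ig1.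
  - by apply: integrableS ig2.
  by rewrite g1E// g2E// -EFinB; congr (_%:E); ring.
exists g; split => //.
have ig' y : mu.-integrable [set` Interval (BRight a) (BRight y)] (EFin \o g).
  by apply: integrableS ig.
have lg : locally_integrable setT g.
  by apply: open_integrable_locally => //; exact: openT.
have := FTC1 ig' lg.
apply: filterS; first exact: (ae_filter_ringOfSetsType mu).
move=> x + axb; move/andP : (axb) => [ax xb].
move=> /(_ ax)[dF F'].
have [Phi [dPhi Phi' PhiE]] : exists Phi : R -> R, [/\ derivable Phi x 1,
    derive1 Phi x = g x & forall y, a < y < b -> Phi y + F a = F y].
  exists (fun y => \int[mu]_(t in [set` `]a, y]]) (g t))%R; split=> // y /andP[ay yb].
  by rewrite /Rintegral gE ?(ltW ay) ?(ltW yb)//=; ring.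
have [d1 d2] := has_derivD (conj dPhi Phi') (has_deriv_cst (F a) x).
have [h1 h2] := eq_on_derive1 axb PhiE d1.
by split => //; rewrite h2 d2 addr0.
Qed.

Lemma lipschitz_abs_continuous a b f (M : R) :
  (forall x y, a <= x -> x <= y -> y <= b -> `|f y - f x| <= M * (y - x)) ->
  abs_continuous a b f.
Proof.
move=> fM e e0; pose K := `|M| + 1; have K0 : 0 < K by rewrite ltr_pwDr.
exists (e / K); first exact: divr_gt0.
move=> n x y xy _; rewrite ltr_pdivlMr// mulrC mulr_sumr => /le_lt_trans; apply.
apply: ler_sum => i _; have [ax [xyi yb]] := xy i.
apply: le_trans (fM _ _ ax xyi yb) _; rewrite ler_wpM2r ?subr_ge0//.
by rewrite (le_trans (ler_norm _))// lerDl.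
Qed.

Lemma abs_continuousD a b f g : abs_continuous a b f -> abs_continuous a b g ->
  abs_continuous a b (fun x => f x + g x).
Proof.
move=> fac gac e e0; have e2 : 0 < e / 2 by lra.
have [d d0 fd] := fac _ e2; have [d' d'0 gd] := gac _ e2.
exists (Num.min d d'); first by rewrite lt_min d0.
move=> n x y xy tI; rewrite lt_min => /andP[/(fd _ _ _ xy tI) h1 /(gd _ _ _ xy tI) h2].
apply: (@le_lt_trans _ _ (\sum_(i < n) `|f (y i) - f (x i)| +
    \sum_(i < n) `|g (y i) - g (x i)|)); last by lra.
rewrite -big_split; apply: ler_sum => i _ /=.
rewrite [X in `|X|](_ : _ = f (y i) - f (x i) + (g (y i) - g (x i))); last ring.
exact: ler_normD.
Qed.

Lemma abs_continuousM a b f g (M : R) :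
  (forall x, a <= x <= b -> `|f x| <= M) -> (forall x, a <= x <= b -> `|g x| <= M) ->
  abs_continuous a b f -> abs_continuous a b g ->
  abs_continuous a b (fun x => f x * g x).
Proof.
move=> fM gM fac gac e e0; pose K := `|M| + 1; have K0 : 0 < K by rewrite ltr_pwDr.
have e2 : 0 < e / K / 2 by rewrite !divr_gt0.
have [d d0 fd] := fac _ e2; have [d' d'0 gd] := gac _ e2.
exists (Num.min d d'); first by rewrite lt_min d0.
move=> n x y xy tI; rewrite lt_min => /andP[/(fd _ _ _ xy tI) h1 /(gd _ _ _ xy tI) h2].
apply: (@le_lt_trans _ _ (K * (\sum_(i < n) `|f (y i) - f (x i)| +
    \sum_(i < n) `|g (y i) - g (x i)|))).
  rewrite -big_split mulr_sumr; apply: ler_sum => i _ /=.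
  have [ax [xyi yb]] := xy i.
  rewrite [X in `|X|](_ : _ = (f (y i) - f (x i)) * g (y i) +
    f (x i) * (g (y i) - g (x i))); last ring.
  rewrite (le_trans (ler_normD _ _))// !normrM mulrDr lerD//.
    rewrite mulrC ler_wpM2r// (le_trans (gM _ _)) ?(le_trans ax)//.
    by rewrite (le_trans (ler_norm _))// lerDl.
  rewrite ler_wpM2r// (le_trans (fM _ _)) ?ax ?(le_trans xyi)//.
  by rewrite (le_trans (ler_norm _))// lerDl.
rewrite mulrC -ltr_pdivlMr//; lra.
Qed.

Lemma C1_abs_continuous a b f :
  (forall x, a <= x <= b -> derivable f x 1) ->
  (forall x, a <= x <= b -> {for x, continuous (derive1 f)}) ->
  abs_continuous a b f.
Proof.
move=> df cf'.
have [ab|ba] := leP a b; last first.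
  apply: (@lipschitz_abs_continuous _ _ _ 0) => x y ax xy yb; lra.
have [M M0 fM] : exists2 M, 0 <= M & forall x, a <= x <= b -> `|derive1 f x| <= M.
  have cab : {within `[a, b], continuous (derive1 f)}.
    apply: continuous_in_subspaceT => x; rewrite inE/= in_itv/=; exact: cf'.
  have := compact_bounded (continuous_compact cab (@segment_compact _ a b)).
  move=> [N [_ HN]]; exists (`|N| + 1); first by rewrite addr_ge0.
  move=> x xab; apply: (HN (`|N| + 1)); first by rewrite (le_lt_trans (ler_norm _))// ltrDl.
  by exists x => //=; rewrite in_itv.
apply: (@lipschitz_abs_continuous _ _ _ M) => x y ax xy yb.
have [|| c] := @MVT_segment _ f (derive1 f) x y xy.
- move=> z; rewrite in_itv/= => /andP[xz zy]; rewrite derive1E; apply: derivableP.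
  by apply: df; apply/andP; lra.
- apply: derivable_within_continuous => z; rewrite in_itv/= => /andP[xz zy].
  by apply: df; apply/andP; lra.
rewrite in_itv/= => /andP[xc cy] ->; rewrite normrM [X in _ * X]ger0_norm ?subr_ge0//.
by rewrite ler_wpM2r ?subr_ge0// fM//; apply/andP; lra.
Qed.

Lemma abs_continuous_continuous a b f x : abs_continuous a b f -> a < x < b ->
  {for x, continuous f}.
Proof.
move=> fac axb; have ab : a <= b by move: axb => /andP[]; lra.
have gc := unif_abs_continuous_cts (unif_abs_continuous_clamp ab fac).
apply: cvg_trans (_ : f (clamp a b y) @[y --> x] --> f x); last first.
  by have := gc x; rewrite /continuous_at /= clamp_id//; lra.
apply: near_eq_cvg; near=> y; have /andP[ay yb] : a < y < b by near: y; exact: near_itvoo.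
by rewrite clamp_id// ltW.
Unshelve. all: by end_near. Qed.

End FTC.

(** * Integrals over the half-line *)

Section AeIntegral.
Context d (T : measurableType d) (R : realType) (mu : {measure set T -> \bar R}).
Implicit Types (f g : T -> \bar R) (D N : set T).
Local Open Scope ereal_scope.
Import HBNNSimple.

Let ge0_ae_le_integral N f g : measurable N -> mu N = 0 ->
  (forall x, 0 <= f x) -> (forall x, 0 <= g x) ->
  (forall x, ~ N x -> f x <= g x) -> \int[mu]_x f x <= \int[mu]_x g x.
Proof.
move=> mN N0 f0 g0 fg; rewrite !ge0_integralTE//.
apply: ge_ereal_sup => _ [h /= hf <-].
have mNc : measurable (~` N) by exact: measurableC.
pose h' := proj_nnsfun h mNc.
have h'E x : (h' x = h x * \1_(~` N) x)%R by rewrite /h' /= mindicE.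
apply: le_ereal_sup_tmp; exists (sintegral mu h').
  exists h' => //; move=> x; rewrite h'E indicE.
  have [/set_mem Nx|xN] := boolP (x \in ~` N).
    by rewrite mulr1 (le_trans (hf x))// fg.
  by rewrite mulr0 g0.
rewrite -!integralT_nnsfun le_eqVlt; apply/orP; left; apply/eqP.
apply: ae_eq_integral => //.
- by apply/measurable_EFinP; exact: measurable_funP.
- by apply/measurable_EFinP; exact: measurable_funP.
exists N; split=> // x /=; apply: contra_notP => Nx _.
by rewrite /= mindicE mem_set// mulr1.
Qed.

(** A derivative need not be Borel measurable, so the usual comparison of
    integrals of measurable functions does not apply to it.  The value of the
    integral is a supremum over simple functions below the integrand, and such
    a function may be set to 0 on a null set. *)
Lemma ae_eq_integral_nonmeasurable D f g :
  {ae mu, forall x, D x -> f x = g x} ->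
  \int[mu]_(x in D) f x = \int[mu]_(x in D) g x.
Proof.
move=> [N [mN N0 DN]].
have fgN x : ~ N x -> D x -> f x = g x.
  by move=> Nx Dx; apply: contra_notP Nx => fg; apply: DN => /= h; exact/fg/h.
have H f' g' : (forall x, 0 <= f' x) -> (forall x, 0 <= g' x) ->
    (forall x, ~ N x -> f' x = g' x) -> \int[mu]_x f' x = \int[mu]_x g' x.
  move=> f0 g0 e; apply/eqP; rewrite eq_le; apply/andP; split;
    by apply: (ge0_ae_le_integral mN N0) => // x /e ->.
rewrite integral_mkcond [RHS]integral_mkcond [LHS]integralE [RHS]integralE.
have E x : ~ N x -> (f \_ D) x = (g \_ D) x.
  by move=> Nx; rewrite !patchE; case: ifPn => // /set_mem Dx; exact: fgN.
by congr (_ - _); apply: H => // x Nx; rewrite ?funeposE ?funenegE E.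
Qed.

End AeIntegral.

Section Improper.
Context {R : realType}.
Notation mu := (@lebesgue_measure R).
Implicit Types (f g h F : R -> R) (a b r s t x C e : R).

Lemma measurable_pos f : (forall x, 0 < x -> {for x, continuous f}) ->
  measurable_fun (`]0, +oo[ : set R) f.
Proof.
move=> cf; apply: open_continuous_measurable_fun; first exact: interval_open.
by move=> x /set_mem; rewrite /= in_itv/= andbT; exact: cf.
Qed.

Lemma measurable_subpos (D : set (measurableTypeR R)) f : measurable D ->
  (forall x, D x -> 0 < x) -> (forall x, 0 < x -> {for x, continuous f}) ->
  measurable_fun D f.
Proof.
move=> mD D0 cf; apply: measurable_funS (measurable_pos cf) => //.
by move=> x /D0; rewrite /= in_itv/= andbT.
Qed.

Lemma powR_cvgy e : e < 0 -> x `^ e @[x --> +oo] --> (0 : R).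
Proof.
move=> e0; apply/cvgrPdist_lt => eps eps0.
near=> x; have x0 : 0 < x by near: x; exact: nbhs_pinfty_gt.
rewrite sub0r normrN ger0_norm ?powR_ge0//.
have xM : eps `^ e^-1 < x by near: x; exact: nbhs_pinfty_gt.
have := @gt0_ltr_powR R (- e) _ _ _ _ _ xM.
rewrite oppr_gt0 => /(_ e0); rewrite !nnegrE powR_ge0 ltW// => /(_ isT isT).
rewrite -powRrM (_ : e^-1 * - e = -1); last by rewrite mulrN mulVf ?lt_eqF.
rewrite powR_inv1 ?ltW// powRN.
by rewrite ltf_pV2 ?posrE// powR_gt0.
Unshelve. all: by end_near. Qed.

Lemma cvg_integral_nondecreasing (S : (set R)^nat) f :
  nondecreasing_seq S -> (forall n, measurable (S n)) ->
  mu.-integrable (\bigcup_n S n) (EFin \o f) ->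
  (\int[mu]_(x in S n) (f x)%:E @[n --> \oo] -->
   \int[mu]_(x in \bigcup_n S n) (f x)%:E)%E.
Proof.
move=> ndS mS fi; pose D := \bigcup_n S n.
have mD : measurable D by exact: bigcup_measurable.
have SD n : S n `<=` D by exact: bigcup_sup.
have mf : measurable_fun D (EFin \o f) by case/integrableP: fi.
have [|||||_ _] := @dominated_convergence _ _ _ mu D mD
  (fun n => (EFin \o f) \_ (S n))%E (EFin \o f) (abse \o (EFin \o f)).
- move=> n; apply/(measurable_restrict _ (mS n) mD).
  by apply: measurable_funS mf => //; exact: subIsetl.
- exact: mf.
- apply: aeW => x [k _ Skx]; apply: cvg_near_cst; exists k => // n /= kn.
  rewrite patchE mem_set//; have := ndS _ _ kn.
  by move/subsetPset; exact.
- exact: integrable_abse.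
- apply: aeW => x n Dx /=; rewrite patchE; case: ifPn => //= _.
  by rewrite normr0 lee_fin.
- suff -> : (fun n => \int[mu]_(x in S n) (f x)%:E)%E =
    (fun n => \int[mu]_(x in D) ((EFin \o f) \_ (S n)) x)%E by [].
  by apply/funext => n/=; rewrite -integral_mkcondr setIidr.
Qed.

Lemma harmonic_pos (n : nat) : 0 < n.+1%:R^-1 :> R.
Proof. by rewrite invr_gt0 ltr0Sn. Qed.

Lemma bigcup_itv_0c t : 0 < t ->
  `]0, t]%classic = \bigcup_n `[t * n.+1%:R^-1, t]%classic.
Proof.
move=> t0; apply/seteqP; split => x /=.
  rewrite in_itv/= => /andP[x0 xt].
  exists (Num.trunc (t / x)) => //=; rewrite in_itv/= xt andbT.
  rewrite ler_pdivrMr ?ltr0Sn// mulrC -ler_pdivrMr//.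
  by apply/ltW/truncnS_gt.
by move=> [n _ /=]; rewrite !in_itv/= => /andP[h ->]; rewrite andbT;
  apply: lt_le_trans h; rewrite mulr_gt0// harmonic_pos.
Qed.

Lemma bigcup_itv_0y :
  `]0, +oo[%classic = \bigcup_n `]n.+1%:R^-1, n.+1%:R]%classic :> set R.
Proof.
apply/seteqP; split => x /=.
  rewrite in_itv/= andbT => x0.
  pose k := (Num.trunc (x^-1) + Num.trunc x)%N.
  exists k.+1 => //=; rewrite in_itv/=; apply/andP; split.
    rewrite invf_plt ?posrE ?ltr0Sn//; apply: lt_trans (truncnS_gt _) _.
    by rewrite ltr_nat !ltnS leq_addr.
  apply/ltW; apply: lt_trans (truncnS_gt _) _.
  by rewrite ltr_nat !ltnS leq_addl.
by move=> [n _ /=]; rewrite !in_itv/= => /andP[h _]; rewrite andbT;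
  apply: lt_trans h; exact: harmonic_pos.
Qed.

Lemma has_deriv_powR_primitive (e x : R) : e != -1 -> 0 < x ->
  has_deriv (fun y => y `^ (e + 1) / (e + 1)) x (x `^ e).
Proof.
move=> e1 x0.
have e0 : e + 1 != 0 by rewrite -[1]opprK subr_eq0.
apply: has_deriv_eq (has_derivM (has_deriv_powR (e + 1) x0) (has_deriv_cst _ x)) _.
by rewrite mulr0 addr0 mulrAC mulfV// mul1r addrK.
Qed.

Lemma integral_powR_segment (e a b : R) : e != -1 -> 0 < a -> a < b ->
  (\int[mu]_(x in `[a, b]) (x `^ e)%:E =
   (b `^ (e + 1) / (e + 1) - a `^ (e + 1) / (e + 1))%:E)%E.
Proof.
move=> e1 a0 ab.
have hd x : a <= x -> has_deriv (fun y => y `^ (e + 1) / (e + 1)) x (x `^ e).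
  by move=> ax; apply: has_deriv_powR_primitive => //; lra.
rewrite EFinB; apply: (@continuous_FTC2 _ _ (fun y => y `^ (e + 1) / (e + 1))) => //.
- apply: continuous_in_subspaceT => x; rewrite inE/= in_itv/= => /andP[ax _].
  by apply: continuous_powR; lra.
- split.
  + by move=> x; rewrite in_itv/= => /andP[ax _]; case: (hd x (ltW ax)).
  + by apply: cvg_at_right_filter; exact: has_deriv_continuous (hd _ _).
  + by apply: cvg_at_left_filter; apply: has_deriv_continuous (hd _ _); lra.
- by move=> x; rewrite in_itv/= => /andP[ax _]; case: (hd x (ltW ax)).
Qed.

Lemma integral_powR_0c (e t : R) : -1 < e -> 0 < t ->
  (\int[mu]_(x in `]0%R, t]) (x `^ e)%:E = (t `^ (e + 1) / (e + 1))%:E)%E.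
Proof.
move=> e1 t0; have e1' : e != -1 by rewrite gt_eqF.
pose S n := `[t * n.+1%:R^-1, t]%classic : set R.
have S0 n : S n `<=` `]0, +oo[%classic.
  move=> x; rewrite /S/= !in_itv/= andbT => /andP[h _].
  by apply: lt_le_trans h; rewrite mulr_gt0// harmonic_pos.
have := @ge0_nondecreasing_set_cvg_integral _ (measurableTypeR R) R S
  (EFin \o (fun x => x `^ e)) mu.
rewrite -bigcup_itv_0c// => H.
suff cv : (\int[mu]_(x in S i) (x `^ e)%:E @[i --> \oo] -->
    (t `^ (e + 1) / (e + 1))%:E)%E.
  apply: (cvg_unique _ (H _ _ _ _) cv) => //.
- move=> m n mn; apply/subsetPset; apply: subset_itvr; rewrite bnd_simp.
  by rewrite ler_wpM2l ?(ltW t0)// lef_pV2 ?posrE ?ltr0Sn// ler_nat.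
- move=> n; exact: measurable_itv.
- move=> n; apply/measurable_EFinP; apply: measurable_funS (S0 n) _ => //.
  by apply: measurable_pos => x x0; exact: continuous_powR.
- by move=> n x _; rewrite lee_fin powR_ge0.
- rewrite -cvg_shiftS/=.
  have -> : (fun n => \int[mu]_(x in S n.+1) (x `^ e)%:E)%E =
    (fun n => (t `^ (e + 1) / (e + 1) - (t * n.+2%:R^-1) `^ (e + 1) / (e + 1))%:E).
    apply/funext => n; rewrite integral_powR_segment//.
      by rewrite mulr_gt0// invr_gt0.
    by rewrite gtr_pMr// invf_lt1// ltr1n.
  apply/cvg_EFin; first exact: nearW.
  rewrite [X in _ --> X](_ : _ = t `^ (e + 1) / (e + 1) - 0 / (e + 1)); last first.
    by rewrite mul0r subr0.
  apply: cvgB; first exact: cvg_cst.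
  apply: cvgMl; have e10 : 0 < e + 1 by lra.
  have h := @powR_cvg0 R _ e10.
  have -> : (fun n => (t * n.+2%:R^-1) `^ (e + 1)) =
     (fun y => y `^ (e + 1)) \o (fun n => t * n.+2%:R^-1) by [].
  apply: cvg_comp h => A /=.
  have : (fun n => t * n.+2%:R^-1) @ \oo --> (0 : R).
    rewrite -[0](mulr0 t); apply: cvgMr.
    by have := @cvg_harmonic R; rewrite -cvg_shiftS.
  move=> cv [d /= d0 dA]; have := cv _ (nbhsx_ballx 0 d d0).
  move=> [N _ HN]; exists N => // n Nn; apply: dA; first exact: HN.
  by rewrite mulr_gt0// invr_gt0.
Qed.

Lemma integral_powR_oy (e r : R) : e < -1 -> 0 < r ->
  (\int[mu]_(x in `]r, +oo[) (x `^ e)%:E = (- (r `^ (e + 1) / (e + 1)))%:E)%E.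
Proof.
move=> e1 r0; have e1' : e != -1 by rewrite lt_eqF.
have hd x : r <= x -> has_deriv (fun y => y `^ (e + 1) / (e + 1)) x (x `^ e).
  by move=> ax; apply: has_deriv_powR_primitive => //; lra.
have cp : {within `[r, +oo[, continuous (fun x => x `^ e)}.
  apply: continuous_in_subspaceT => x; rewrite inE/= in_itv/= andbT => ax.
  by apply: continuous_powR; lra.
rewrite integral_itv_obnd_cbnd; last first.
  apply/measurable_EFinP; apply: measurable_subpos => [|x|x x0].
  - exact: measurable_itv.
  - by rewrite /= in_itv/= andbT; exact: lt_trans.
  - exact: continuous_powR.
rewrite (@ge0_continuous_FTC2y _ _ (fun y => y `^ (e + 1) / (e + 1)) r 0) //.
- by rewrite sub0e.
- by move=> x _; exact: powR_ge0.
- rewrite -[0 in X in _ --> X](mul0r (e + 1)^-1); apply: cvgMl.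
  by apply: powR_cvgy; lra.
- by move=> x ax; case: (hd x (ltW ax)).
- by apply: cvg_at_right_filter; exact: has_deriv_continuous (hd _ _).
- by move=> x; rewrite in_itv/= andbT => ax; case: (hd x (ltW ax)).
Qed.

End Improper.

Section Primitives.
Context {R : realType}.
Notation mu := (@lebesgue_measure R).
Notation pos := (`]0, +oo[%classic : set R).
Implicit Types (f g h F : R -> R) (a b r s t x C e : R).

Lemma posP x : pos x <-> 0 < x.
Proof. by rewrite /= in_itv/= andbT. Qed.

Lemma measurable_powR_pos s : measurable_fun pos (fun x => x `^ s).
Proof. by apply: measurable_pos => x x0; exact: continuous_powR. Qed.

Lemma itv_0c_pos t x : `]0, t]%classic x -> 0 < x.
Proof. by rewrite /= in_itv/= => /andP[]. Qed.

Lemma itv_oy_pos r x : 0 < r -> `]r, +oo[%classic x -> 0 < x.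
Proof. by move=> r0; rewrite /= in_itv/= andbT; exact: lt_trans. Qed.

Lemma integrable_powR_0c e t C : -1 < e -> 0 < t ->
  mu.-integrable `]0, t] (fun x => (C * x `^ e)%:E).
Proof.
move=> e1 t0; rewrite (_ : (fun x => _) = (fun x => C%:E * (x `^ e)%:E))%E; last first.
  by apply/funext => x; rewrite EFinM.
apply: integrableZl; first exact: measurable_itv.
apply/integrableP; split.
  apply/measurable_EFinP; apply: measurable_subpos => [|x|x x0].
  - exact: measurable_itv.
  - exact: itv_0c_pos.
  - exact: continuous_powR.
under eq_integral do rewrite gee0_abs ?lee_fin ?powR_ge0//.
by rewrite integral_powR_0c// ltry.
Qed.

Lemma integrable_powR_oy e r C : e < -1 -> 0 < r ->
  mu.-integrable `]r, +oo[ (fun x => (C * x `^ e)%:E).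
Proof.
move=> e1 r0; rewrite (_ : (fun x => _) = (fun x => C%:E * (x `^ e)%:E))%E; last first.
  by apply/funext => x; rewrite EFinM.
apply: integrableZl; first exact: measurable_itv.
apply/integrableP; split.
  apply/measurable_EFinP; apply: measurable_subpos => [|x|x x0].
  - exact: measurable_itv.
  - exact: itv_oy_pos.
  - exact: continuous_powR.
under eq_integral do rewrite gee0_abs ?lee_fin ?powR_ge0//.
by rewrite integral_powR_oy// ltry.
Qed.

Lemma sub_0c_pos t : `]0, t]%classic `<=` pos.
Proof. by move=> x /itv_0c_pos; rewrite /= in_itv/= andbT. Qed.

Lemma sub_oy_pos r : 0 < r -> `]r, +oo[%classic `<=` pos.
Proof. by move=> r0 x /(itv_oy_pos r0); rewrite /= in_itv/= andbT. Qed.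

Lemma integrable_0c f e t C : -1 < e -> 0 < t -> measurable_fun pos f ->
  (forall x, 0 < x -> `|f x| <= C * x `^ e) ->
  mu.-integrable `]0, t] (EFin \o f).
Proof.
move=> e1 t0 mf fC; apply: le_integrable (integrable_powR_0c C e1 t0).
- exact: measurable_itv.
- by apply/measurable_EFinP; apply: measurable_funS mf => //; exact: sub_0c_pos.
- move=> x /itv_0c_pos x0 /=; rewrite lee_fin.
  by apply: le_trans (fC _ x0) _; exact: ler_norm.
Qed.

Lemma integrable_oy f e r C : e < -1 -> 0 < r -> measurable_fun pos f ->
  (forall x, 0 < x -> `|f x| <= C * x `^ e) ->
  mu.-integrable `]r, +oo[ (EFin \o f).
Proof.
move=> e1 r0 mf fC; apply: le_integrable (integrable_powR_oy C e1 r0).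
- exact: measurable_itv.
- by apply/measurable_EFinP; apply: measurable_funS mf => //; exact: sub_oy_pos.
- move=> x /(itv_oy_pos r0) x0 /=; rewrite lee_fin.
  by apply: le_trans (fC _ x0) _; exact: ler_norm.
Qed.

(** A power bound with exponent above [-1] controls the integral near 0, one
    with exponent below [-1] controls it near infinity. *)
Lemma integrable_pos f e1 e2 C : e1 < -1 -> -1 < e2 -> measurable_fun pos f ->
  (forall x, 0 < x -> `|f x| <= C * x `^ e1) ->
  (forall x, 0 < x -> `|f x| <= C * x `^ e2) ->
  mu.-integrable pos (EFin \o f).
Proof.
move=> h1 h2 mf f1 f2.
have -> : pos = `]0, 1]%classic `|` `]1, +oo[%classic.
  by rewrite -itv_bndbnd_setU// bnd_simp.
apply/integrableP; split.
  rewrite -itv_bndbnd_setU ?bnd_simp//; exact/measurable_EFinP.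
have /integrableP[_ i1] := integrable_0c h2 ltr01 mf f2.
have /integrableP[_ i2] := integrable_oy h1 ltr01 mf f1.
rewrite ge0_integral_setU//.
- by rewrite lte_add_pinfty.
- rewrite -itv_bndbnd_setU ?bnd_simp//; apply: measurableT_comp => //.
  exact/measurable_EFinP.
- apply/disj_setPS => x [] /=; rewrite !in_itv/= andbT => /andP[_ h]; lra.
Qed.

Lemma le_normr_Rintegral_bound (D : set (measurableTypeR R)) f g : measurable D ->
  mu.-integrable D (EFin \o f) -> mu.-integrable D (EFin \o g) ->
  (forall x, D x -> `|f x| <= g x) ->
  `|Rintegral mu D f| <= Rintegral mu D g.
Proof.
move=> mD fi gi fg; apply: le_trans (le_normr_Rintegral _ fi) _ => //.
by apply: le_Rintegral => //; exact: integrable_norm.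
Qed.

Definition int0 f t := (\int[mu]_(s in `]0%R, t[) f s)%R.

Definition inty f r := (\int[mu]_(s in `]r, +oo[) f s)%R.

Lemma int0_0c f e t C : -1 < e -> 0 < t -> measurable_fun pos f ->
  (forall x, 0 < x -> `|f x| <= C * x `^ e) ->
  int0 f t = (\int[mu]_(s in `]0%R, t]) f s)%R.
Proof.
move=> e1 t0 mf fC; apply: Rintegral_itv_bndo_bndc.
apply: integrableS (integrable_0c e1 t0 mf fC) => //.
by apply: subset_itvl; rewrite bnd_simp.
Qed.

Lemma int0_bound f e t C : -1 < e -> 0 < t -> measurable_fun pos f ->
  (forall x, 0 < x -> `|f x| <= C * x `^ e) ->
  `|int0 f t| <= C / (e + 1) * t `^ (e + 1).
Proof.
move=> e1 t0 mf fC; rewrite (int0_0c e1 t0 mf fC).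
apply: le_trans (le_normr_Rintegral_bound _ (integrable_0c e1 t0 mf fC)
  (integrable_powR_0c C e1 t0) _) _; first exact: measurable_itv.
  by move=> x /itv_0c_pos; exact: fC.
rewrite RintegralZl; last 2 first.
- exact: measurable_itv.
- have := integrable_powR_0c 1 e1 t0; congr (_.-integrable _ _).
  by apply/funext => x/=; rewrite mul1r.
by rewrite /Rintegral integral_powR_0c//= mulrA mulrAC.
Qed.

Lemma inty_bound f e r C : e < -1 -> 0 < r -> measurable_fun pos f ->
  (forall x, 0 < x -> `|f x| <= C * x `^ e) ->
  `|inty f r| <= C / (- (e + 1)) * r `^ (e + 1).
Proof.
move=> e1 r0 mf fC.
apply: le_trans (le_normr_Rintegral_bound _ (integrable_oy e1 r0 mf fC)
  (integrable_powR_oy C e1 r0) _) _; first exact: measurable_itv.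
  by move=> x /(itv_oy_pos r0); exact: fC.
rewrite RintegralZl; last 2 first.
- exact: measurable_itv.
- have := integrable_powR_oy 1 e1 r0; congr (_.-integrable _ _).
  by apply/funext => x/=; rewrite mul1r.
by rewrite /Rintegral integral_powR_oy//= invrN !mulrN mulNr mulrA mulrAC.
Qed.

Lemma has_deriv_int0 f e C x : -1 < e -> 0 < x ->
  (forall x, 0 < x -> {for x, continuous f}) ->
  (forall x, 0 < x -> `|f x| <= C * x `^ e) ->
  has_deriv (int0 f) x (f x).
Proof.
move=> e1 x0 cf fC; have mf := measurable_pos cf.
apply: (@has_deriv_pos _
  (fun t => (\int[mu]_(s in [set` Interval (BRight 0) (BRight t)]) f s)%R)) => //.
  by move=> y y0; rewrite (int0_0c e1 y0 mf fC).
have x1 : x < x + 1 by rewrite ltrDl.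
apply: (@continuous_FTC1 _ f (BRight 0) x (x + 1) x1) => //.
- by apply: (integrable_0c e1 _ mf fC); lra.
- exact: cf.
Qed.

(** Near [x] the integral to infinity differs from the integral up to the
    moving end point by a constant. *)
Lemma has_deriv_inty f e C x : e < -1 -> 0 < x ->
  (forall x, 0 < x -> {for x, continuous f}) ->
  (forall x, 0 < x -> `|f x| <= C * x `^ e) ->
  has_deriv (inty f) x (- f x).
Proof.
move=> e1 x0 cf fC; have mf := measurable_pos cf.
pose c := x / 2; have c0 : 0 < c by rewrite divr_gt0.
pose Phi t := (\int[mu]_(s in [set` Interval (BRight c) (BRight t)]) f s)%R.
have x1 : x < x + 1 by rewrite ltrDl.
have xc : c < x by rewrite /c; lra.
have ic t : mu.-integrable `]c, t] (EFin \o f).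
  by apply: integrableS (integrable_oy e1 c0 mf fC) => //; exact: subset_itvl.
have hPhi : has_deriv Phi x (f x).
  by apply: (@continuous_FTC1 _ f (BRight c) x (x + 1) x1) => //; exact: cf.
have h : has_deriv (fun t => inty f c - Phi t) x (- f x).
  apply: has_deriv_eq (has_derivB (has_deriv_cst _ x) hPhi) _.
  by rewrite sub0r.
apply: has_deriv_near h; near=> t.
have ct : c < t by near: t; exact: lt_nbhsr.
rewrite /inty /Phi Rintegral_itvB//.
- exact: integrable_oy e1 c0 mf fC.
- by rewrite bnd_simp ltW.
Unshelve. all: by end_near. Qed.

(** Integrability of [f] is what allows the passage to the limit along the
    intervals from [1 / n] to [n]. *)
Lemma integral_pos_primitive f B : mu.-integrable pos (EFin \o f) ->
  (forall a b, 0 < a -> a < b -> (\int[mu]_(t in `]a, b]) (f t)%:E = (B b - B a)%:E)%E) ->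
  B x @[x --> 0^'+] --> (0 : R) -> B x @[x --> +oo] --> (0 : R) ->
  (\int[mu]_(t in pos) (f t)%:E = 0)%E.
Proof.
move=> fi fB B0 By.
pose S (n : nat) := `]n.+1%:R^-1, n.+1%:R]%classic : set R.
have ndS : nondecreasing_seq S.
  move=> m n mn; apply/subsetPset => x; rewrite /S/= !in_itv/= => /andP[h1 h2].
  apply/andP; split; last by rewrite (le_trans h2)// ler_nat.
  by apply: le_lt_trans h1; rewrite lef_pV2 ?posrE ?ltr0Sn// ler_nat.
have mS n : measurable (S n) by exact: measurable_itv.
have := cvg_integral_nondecreasing ndS mS; rewrite -bigcup_itv_0y => /(_ _ fi) cv.
suff cv0 : (\int[mu]_(x in S n) (f x)%:E @[n --> \oo] --> 0)%E.
  exact: (cvg_unique _ cv cv0).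
rewrite -cvg_shiftS/=.
have -> : (fun n => \int[mu]_(x in S n.+1) (f x)%:E)%E =
    (fun n => (B n.+2%:R - B n.+2%:R^-1)%:E).
  apply/funext => n; rewrite fB ?invr_gt0//.
  apply: (@lt_trans _ _ 1); first by rewrite invf_lt1// ltr1n.
  by rewrite ltr1n.
apply/cvg_EFin; first exact: nearW.
rewrite -[0](subr0 0); apply: cvgB.
  move/cvg_pinftyP : By; apply; apply/cvgryPge => M.
  near=> n; apply: (@le_trans _ _ n%:R); last by rewrite ler_nat ltnW.
  by near: n; exact: nbhs_infty_ger.
move/cvg_at_rightP : B0; apply; split => [n|]; first by rewrite invr_gt0.
by have := @cvg_harmonic R; rewrite -cvg_shiftS.
Unshelve. all: by end_near. Qed.

End Primitives.

(** * Functions with power bounds on their derivatives *)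

Section SymbolClass.
Context {R : realType}.
Implicit Types (y z : R -> R) (P : R -> (R -> R) -> Prop) (g s c : R) (k : nat).

(** As for symbols of differential operators, each derivative costs one power:
    [y] and its derivatives up to order [k] satisfy [P] with the exponents
    [g, g - 1, ..., g - k].  The predicate [P g y] is a notion of being of size
    [x^g], which is a pointwise bound, together with more or less regularity. *)
Fixpoint symbol P k g y : Prop :=
  match k with
  | 0 => P g y
  | k'.+1 => [/\ P g y, (forall x : R, 0 < x -> derivable y x 1) &
                 symbol P k' (g - 1) (derive1 y)]
  end.

(** What [P] must satisfy for the class [symbol P] to be stable under sums and
    under multiplication by powers.  Only the values on the positive half-line
    may matter. *)
Record symbol_base P : Prop := {
  base_ext : forall g y z, (forall x : R, 0 < x -> y x = z x) -> P g y -> P g z;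
  base_add : forall g y z, P g y -> P g z -> P g (fun x => y x + z x);
  base_pow : forall g y s c, P g y -> P (g + s) (fun x => c * x `^ s * y x) }.

Section Theory.
Variable P : R -> (R -> R) -> Prop.
Hypothesis bP : symbol_base P.

Lemma symbolW k g y : symbol P k g y -> P g y.
Proof. by case: k => [//|k []]. Qed.

Lemma symbol_le k l g y : (l <= k)%N -> symbol P k g y -> symbol P l g y.
Proof.
elim: l k g y => [|l IH] k g y; first by move=> _ /symbolW.
by case: k => // k lk [h1 h2 h3]; split => //; exact: IH h3.
Qed.

Lemma symbol_ext k g y z : (forall x : R, 0 < x -> y x = z x) ->
  symbol P k g y -> symbol P k g z.
Proof.
elim: k g y z => [|k IH] g y z yz; first exact: (base_ext bP).
move=> [h1 h2 h3]; split; first exact: (base_ext bP) h1.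
- move=> x x0; have [//] : has_deriv z x (derive1 y x).
  by apply: (has_deriv_pos x0 yz); split => //; exact: h2.
- by apply: IH h3 => x x0; exact: eq_derive1_pos.
Qed.

Lemma symbolD k g y z : symbol P k g y -> symbol P k g z ->
  symbol P k g (fun x => y x + z x).
Proof.
elim: k g y z => [|k IH] g y z; first exact: (base_add bP).
move=> [h1 h2 h3] [h1' h2' h3'].
have hd x : 0 < x -> has_deriv (fun x => y x + z x) x (derive1 y x + derive1 z x).
  by move=> x0; apply: has_derivD; split => //; [exact: h2|exact: h2'].
split; first exact: (base_add bP).
- by move=> x /hd[].
- by apply: symbol_ext (IH _ _ _ h3 h3') => x /hd[].
Qed.

Lemma symbol_pow k g y s c : symbol P k g y ->
  symbol P k (g + s) (fun x => c * x `^ s * y x).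
Proof.
elim: k g y s c => [|k IH] g y s c; first exact: (base_pow bP).
move=> h; have [h1 h2 h3] := h.
have hd x : 0 < x -> has_deriv (fun x => c * x `^ s * y x) x
    ((c * s) * x `^ (s - 1) * y x + c * x `^ s * derive1 y x).
  move=> x0; apply: has_deriv_eq (has_derivM (has_derivZ c (has_deriv_powR s x0))
    (conj (h2 x x0) erefl)) _.
  by rewrite mulrA.
split; first exact: (base_pow bP).
- by move=> x /hd[].
- apply: (@symbol_ext _ _
    (fun x => (c * s) * x `^ (s - 1) * y x + c * x `^ s * derive1 y x)).
    by move=> x /hd[].
  apply: symbolD.
    have := IH _ _ (s - 1) (c * s) (symbol_le (leqnSn k) h).
    by rewrite addrA.
  by have := IH _ _ s c h3; rewrite addrAC.
Qed.

Lemma symbolZ k g y c : symbol P k g y -> symbol P k g (fun x => c * y x).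
Proof.
move=> /(symbol_pow 0 c); rewrite addr0; apply: symbol_ext => x x0.
by rewrite powRr0 mulr1.
Qed.

Lemma symbol_derive1n k j g y : (j <= k)%N -> symbol P k g y ->
  symbol P (k - j) (g - j%:R) (derive1n j y).
Proof.
elim: j => [|j IH] jk h; first by rewrite subn0 subr0.
have := IH (ltnW jk) h; rewrite -(subnSK jk) => -[_ _].
by rewrite -addrA -opprD natr1.
Qed.

Lemma symbol_derivable k j g y x : (j < k)%N -> symbol P k g y -> 0 < x ->
  derivable (derive1n j y) x 1.
Proof.
move=> jk /(symbol_derive1n (ltnW jk)); rewrite -(subnSK jk) => -[_ h _] x0.
exact: h.
Qed.

End Theory.

Definition pow_bounded g y := exists C, forall x : R, 0 < x -> `|y x| <= C * x `^ g.

Definition cont_symbol g y :=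
  (forall x : R, 0 < x -> {for x, continuous y}) /\ pow_bounded g y.

Lemma pow_bounded_ge0 g y : pow_bounded g y ->
  exists2 C, 0 <= C & forall x : R, 0 < x -> `|y x| <= C * x `^ g.
Proof.
move=> [C yC]; exists `|C| => // x x0; apply: le_trans (yC x x0) _.
by rewrite ler_wpM2r ?powR_ge0// ler_norm.
Qed.

Lemma pow_bounded_ext g y z : (forall x : R, 0 < x -> y x = z x) ->
  pow_bounded g y -> pow_bounded g z.
Proof. by move=> yz [C yC]; exists C => x x0; rewrite -yz// yC. Qed.

Lemma pow_boundedD g y z : pow_bounded g y -> pow_bounded g z ->
  pow_bounded g (fun x => y x + z x).
Proof.
move=> [C yC] [D zD]; exists (C + D) => x x0.
by rewrite (le_trans (ler_normD _ _))// mulrDl lerD ?yC ?zD.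
Qed.

Lemma powRDpos x g s : 0 < x -> x `^ (g + s) = x `^ g * x `^ s.
Proof. by move=> x0; rewrite powRD// (gt_eqF x0) implybT. Qed.

Lemma pow_boundedM g s y z : pow_bounded g y -> pow_bounded s z ->
  pow_bounded (g + s) (fun x => y x * z x).
Proof.
move=> /pow_bounded_ge0[C C0 yC] /pow_bounded_ge0[D D0 zD]; exists (C * D) => x x0.
by rewrite normrM powRDpos// mulrACA ler_pM ?yC ?zD.
Qed.

Lemma pow_boundedZ c g y : pow_bounded g y -> pow_bounded g (fun x => c * y x).
Proof.
move=> /pow_bounded_ge0[C C0 yC]; exists (`|c| * C) => x x0.
by rewrite normrM -mulrA ler_wpM2l// yC.
Qed.

Lemma pow_bounded_powR s : pow_bounded s (fun x => x `^ s).
Proof. by exists 1 => x x0; rewrite mul1r ger0_norm// powR_ge0. Qed.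

Lemma pow_bounded_pow s c : pow_bounded s (fun x => c * x `^ s).
Proof. by apply: pow_boundedZ; exact: pow_bounded_powR. Qed.

Lemma cont_symbol_base : symbol_base cont_symbol.
Proof.
split.
- move=> g y z yz [cy by']; split; last exact: pow_bounded_ext by'.
  by move=> x x0; apply: (continuous_pos x0 yz); exact: cy.
- move=> g y z [cy by'] [cz bz]; split; last exact: pow_boundedD.
  by move=> x x0; apply: continuousD; [exact: cy|exact: cz].
- move=> g y s c [cy by']; split.
    move=> x x0; apply: continuousM; last exact: cy.
    by apply: continuousM; [exact: cst_continuous|exact: continuous_powR].
  by rewrite addrC; apply: pow_boundedM by'; exact: pow_bounded_pow.
Qed.

Lemma pow_bounded_cvg0 g y : 0 < g -> pow_bounded g y -> y x @[x --> 0^'+] --> (0 : R).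
Proof.
move=> g0 [C yC].
have hC : C * x `^ g @[x --> 0^'+] --> (0 : R).
  rewrite [X in _ --> X](_ : _ = C * 0); last by rewrite mulr0.
  by apply: cvgMr; exact: powR_cvg0.
apply: (@squeeze_cvgr _ _ _ _ (fun x => - (C * x `^ g)) (fun x => C * x `^ g)).
- near=> x; have x0 : 0 < x by near: x; exact: nbhs_right_gt.
  by rewrite -ler_norml yC.
- by move/cvgN : hC; rewrite oppr0.
- by [].
Unshelve. all: by end_near. Qed.

Lemma pow_bounded_cvgy g y : g < 0 -> pow_bounded g y -> y x @[x --> +oo] --> (0 : R).
Proof.
move=> g0 [C yC].
have hC : C * x `^ g @[x --> +oo] --> (0 : R).
  rewrite [X in _ --> X](_ : _ = C * 0); last by rewrite mulr0.
  by apply: cvgMr; exact: powR_cvgy.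
apply: (@squeeze_cvgr _ _ _ _ (fun x => - (C * x `^ g)) (fun x => C * x `^ g)).
- near=> x; have x0 : 0 < x by near: x; exact: nbhs_pinfty_gt.
  by rewrite -ler_norml yC.
- by move/cvgN : hC; rewrite oppr0.
- by [].
Unshelve. all: by end_near. Qed.

End SymbolClass.

(** * The inverse of the radial Laplacian *)

Section RadialInverse.
Context {R : realType}.
Notation mu := (@lebesgue_measure R).
Implicit Types (y z h : R -> R) (g s c a : R) (k : nat).

(** The inverse of [- laplacian a] on functions of size [x^g] with
    [- (a + 1) < g < -2]: the first inequality makes the inner integral converge
    at 0, the second one makes the outer integral converge at infinity. *)
Definition radial_inv a h : R -> R :=
  inty (fun t => t `^ (- a) * int0 (fun s => h s * s `^ a) t).

(** The gain of regularity for a first order equation: the equation expresses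
    the derivative of [y] by [y] and [h], so each order of regularity of [h]
    gives one more order for [y]. *)
Lemma cont_symbol_ode a g y h k : (forall x, 0 < x ->
    has_deriv y x (- a * x `^ (-1) * y x - h x)) ->
  cont_symbol (g + 1) y -> symbol cont_symbol k g h ->
  symbol cont_symbol k.+1 (g + 1) y.
Proof.
move=> yh ys; elim: k h yh => [|k IH] h yh hs.
  split => //; first by move=> x /yh[].
  rewrite addrK; apply: (@base_ext _ _ (@cont_symbol_base R) _
      (fun x => - a * x `^ (-1) * y x + - 1 * h x)).
    by move=> x /yh[_ ->]; rewrite mulN1r.
  apply: (base_add (@cont_symbol_base R)).
    by have := base_pow (@cont_symbol_base R) (-1) (- a) ys; rewrite addrK.
  exact: (@symbolZ _ _ (@cont_symbol_base R) 0).
have ysk := IH h yh (symbol_le (leqnSn k) hs).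
split => //; first by move=> x /yh[].
rewrite addrK; apply: (@symbol_ext _ _ (@cont_symbol_base R) _ _
    (fun x => - a * x `^ (-1) * y x + - 1 * h x)).
  by move=> x /yh[_ ->]; rewrite mulN1r.
apply: (symbolD (@cont_symbol_base R)); last exact: (symbolZ (@cont_symbol_base R)).
by have := symbol_pow (@cont_symbol_base R) (-1) (- a) ysk; rewrite addrK.
Qed.

Section OneFunction.
Variables (a g : R) (h : R -> R) (k : nat).
Hypotheses (g1 : - (a + 1) < g) (g2 : g < -2) (hs : symbol cont_symbol k g h).

Let hc : cont_symbol (g + a) (fun s => h s * s `^ a).
Proof.
have := base_pow (@cont_symbol_base R) a 1 (symbolW hs).
apply: base_ext; first exact: cont_symbol_base.
by move=> x _; rewrite mul1r mulrC.
Qed.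

Let A t := int0 (fun s => h s * s `^ a) t.

Let ga1 : -1 < g + a. Proof. move: g1; lra. Qed.

Let hA x : 0 < x -> has_deriv A x (h x * x `^ a).
Proof. by move=> x0; have [c1 [C bC]] := hc; exact: has_deriv_int0 ga1 x0 c1 bC. Qed.

Let bA : cont_symbol (g + a + 1) A.
Proof.
split; first by move=> x x0; exact: has_deriv_continuous (hA x0).
have [c1 [C bC]] := hc; exists (C / (g + a + 1)) => x x0.
exact: (int0_bound ga1 x0 (measurable_pos c1) bC).
Qed.

Let B t := t `^ (- a) * A t.

Let bB : cont_symbol (g + 1) B.
Proof.
have := base_pow (@cont_symbol_base R) (- a) 1 bA.
rewrite (_ : g + a + 1 - a = g + 1); last ring.
apply: base_ext; first exact: cont_symbol_base.
by move=> x _; rewrite mul1r.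
Qed.

Let hB x : 0 < x -> has_deriv B x (- a * x `^ (-1) * B x + h x).
Proof.
move=> x0; apply: has_deriv_eq (has_derivM (has_deriv_powR (- a) x0) (hA x0)) _.
have -> : x `^ (- a) * (h x * x `^ a) = h x.
  by rewrite mulrCA -powRDpos// addNr powRr0 mulr1.
by rewrite powRDpos// /B; ring.
Qed.

Let g11 : g + 1 < -1. Proof. move: g2; lra. Qed.

Lemma has_deriv_radial_inv x : 0 < x ->
  has_deriv (radial_inv a h) x (- (x `^ (- a) * int0 (fun s => h s * s `^ a) x)).
Proof. by move=> x0; have [c1 [C bC]] := bB; exact: has_deriv_inty g11 x0 c1 bC. Qed.

(** The derivative of [radial_inv a h] is minus [x^(-a)] times the inner
    integral; it solves the first order equation of [cont_symbol_ode]. *)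
Lemma symbol_radial_inv : symbol cont_symbol k.+2 (g + 2) (radial_inv a h).
Proof.
split.
- split; first by move=> x x0; exact: has_deriv_continuous (has_deriv_radial_inv x0).
  have [c1 [C bC]] := bB; exists (C / - (g + 1 + 1)) => x x0.
  have := inty_bound g11 x0 (measurable_pos c1) bC.
  by rewrite -addrA.
- by move=> x /has_deriv_radial_inv[].
rewrite (_ : g + 2 - 1 = g + 1); last ring.
apply: (@symbol_ext _ _ (@cont_symbol_base R) _ _ (fun x => -1 * B x)).
  by move=> x /has_deriv_radial_inv[_ ->]; rewrite mulN1r.
apply: (@cont_symbol_ode a _ _ h) => //.
- move=> x x0; apply: has_deriv_eq (has_derivZ (-1) (hB x0)) _; ring.
- exact: (@symbolZ _ _ (@cont_symbol_base R) 0).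
Qed.

Lemma laplacian_radial_inv x : 0 < x -> laplacian a (radial_inv a h) x = - h x.
Proof.
move=> x0; rewrite /laplacian.
have [_ ->] : has_deriv (fun s => s `^ a * derive1 (radial_inv a h) s) x
    (- (h x * x `^ a)).
  apply: (has_deriv_pos x0 _ (has_derivN (hA x0))) => t t0.
  have [_ ->] := has_deriv_radial_inv t0.
  by rewrite mulrN mulrA -powRDpos// subrr powRr0 mul1r.
by rewrite mulrN mulrCA -powRDpos// addNr powRr0 mulr1.
Qed.

Lemma radial_inv_integral r : 0 < r ->
  ((radial_inv a h r)%:E = \int[mu]_(t in `]r, +oo[) ((t `^ (- a))%:E *
     \int[mu]_(s in `]0%R, t[) (h s * s `^ a)%:E))%E.
Proof.
move=> r0; have [c1 [C bC]] := hc; have [c1' [C' bC']] := bB.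
rewrite /radial_inv /inty /Rintegral fineK; last first.
  apply: integrable_fin_num => //.
  exact: integrable_oy g11 r0 (measurable_pos c1') bC'.
apply: eq_integral => t; rewrite inE => /(itv_oy_pos r0) t0.
rewrite EFinM /int0 /Rintegral fineK//; apply: integrable_fin_num => //.
apply: integrableS (integrable_0c ga1 t0 (measurable_pos c1) bC) => //.
by apply: subset_itvl; rewrite bnd_simp.
Qed.

End OneFunction.

End RadialInverse.

(** * Absolutely continuous functions with power bounds, and integration by parts *)

Section WeakSymbol.
Context {R : realType}.
Notation mu := (@lebesgue_measure R).
Notation pos := (`]0, +oo[%classic : set R).
Implicit Types (y z h : R -> R) (g s c e a b x : R) (k : nat).

Lemma ae_mono (P Q : R -> Prop) : (forall x, P x -> Q x) ->
  {ae mu, forall x, P x} -> {ae mu, forall x, Q x}.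
Proof. by move=> PQ; apply: filterS => //; exact: (ae_filter_ringOfSetsType mu). Qed.

Lemma ae_and (P Q : R -> Prop) : {ae mu, forall x, P x} -> {ae mu, forall x, Q x} ->
  {ae mu, forall x, P x /\ Q x}.
Proof. by apply: filterI; exact: (ae_filter_ringOfSetsType mu). Qed.

(** [h] behaves like a function of size [x^g] when it is integrated: the
    exponents are those for which the product would be [O(x^(-1+e))] and
    [O(x^(-1-e))].  This is the information on the highest derivative of a
    function of finite energy, for which no pointwise bound holds. *)
Definition pairable g h := forall z e, 0 < e -> measurable_fun pos z ->
  pow_bounded (- 1 - g + e) z -> pow_bounded (- 1 - g - e) z ->
  mu.-integrable pos (EFin \o (fun x => h x * z x)).

Definition ae_deriv y h := {ae mu, forall x, 0 < x -> has_deriv y x (h x)}.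

(** The analogue of [cont_symbol] with one more derivative, which exists only
    almost everywhere and is only controlled in the sense of [pairable].  The
    function [h] is a Borel version of that derivative. *)
Definition weak_symbol g y := [/\ loc_abs_continuous y, pow_bounded g y &
  exists h, [/\ measurable_fun pos h, ae_deriv y h & pairable (g - 1) h]].

Lemma integrable_pos_bounded y e : 0 < e -> measurable_fun pos y ->
  pow_bounded (- 1 + e) y -> pow_bounded (- 1 - e) y ->
  mu.-integrable pos (EFin \o y).
Proof.
move=> e0 my /pow_bounded_ge0[C C0 yC] /pow_bounded_ge0[D D0 yD].
apply: (@integrable_pos _ _ (- 1 - e) (- 1 + e) (C + D)) => //; [lra|lra| |] => x x0.
  by apply: le_trans (yD x x0) _; rewrite ler_wpM2r ?powR_ge0// lerDr.
by apply: le_trans (yC x x0) _; rewrite ler_wpM2r ?powR_ge0// lerDl.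
Qed.

Lemma pow_bounded_pairable g y : measurable_fun pos y -> pow_bounded g y ->
  pairable g y.
Proof.
move=> my by' z e e0 mz bz1 bz2; apply: (@integrable_pos_bounded _ e) => //.
- exact: measurable_funM.
- by have := pow_boundedM by' bz1; congr pow_bounded; ring.
- by have := pow_boundedM by' bz2; congr pow_bounded; ring.
Qed.

(** The weight [-1 - 2 g] is the critical one for functions of size [x^g]; the
    product is bounded by the sum of the weighted squares. *)
Lemma square_integrable_pairable g h : measurable_fun pos h ->
  mu.-integrable pos (EFin \o (fun x => h x ^+ 2 * x `^ (- 1 - 2 * g))) ->
  pairable g h.
Proof.
move=> mh ih z e e0 mz bz1 bz2.
have mp := @measurable_powR_pos R.
have iz : mu.-integrable pos (EFin \o (fun x => z x ^+ 2 * x `^ (1 + 2 * g))).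
  have e20 : 0 < 2 * e by lra.
  have bp := @pow_bounded_powR R (1 + 2 * g).
  apply: (@integrable_pos_bounded _ (2 * e)) => //.
  - by apply: measurable_funM => //; exact: measurable_funX.
  - have := pow_boundedM (pow_boundedM bz1 bz1) bp.
    by congr pow_bounded; ring.
  - have := pow_boundedM (pow_boundedM bz2 bz2) bp.
    by congr pow_bounded; ring.
apply: le_integrable (integrableD _ ih iz) => //.
- by apply/measurable_EFinP; exact: measurable_funM.
- move=> x /posP x0 /=; rewrite lee_fin; apply: le_trans (ler_norm _).
  set p := x `^ (- 1 - 2 * g).
  have -> : x `^ (1 + 2 * g) = p^-1.
    by rewrite /p -powRN; congr (_ `^ _); ring.
  have p0 : 0 < p by exact: powR_gt0.
  rewrite normrM; set u := `|h x|; set v := `|z x|.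
  have <- : u ^+ 2 = h x ^+ 2 by rewrite /u real_normK ?num_real.
  have <- : v ^+ 2 = z x ^+ 2 by rewrite /v real_normK ?num_real.
  rewrite -subr_ge0.
  have -> : u ^+ 2 * p + v ^+ 2 / p - u * v =
    p^-1 * ((u * p - v / 2) ^+ 2 + 3 / 4 * v ^+ 2) by field; rewrite gt_eqF.
  by rewrite mulr_ge0 ?invr_ge0 ?(ltW p0)// addr_ge0 ?sqr_ge0// mulr_ge0// sqr_ge0.
Qed.

Lemma loc_abs_continuous_cts y x : loc_abs_continuous y -> 0 < x ->
  {for x, continuous y}.
Proof.
move=> yac x0; have [x1 x2 x3] : [/\ 0 < x / 2, x / 2 < x & x < x + 1] by split; lra.
apply: (@abs_continuous_continuous _ (x / 2) (x + 1)); last by rewrite x2 x3.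
by apply: yac => //; lra.
Qed.

Lemma loc_abs_continuousM y z : loc_abs_continuous y -> loc_abs_continuous z ->
  loc_abs_continuous (fun x => y x * z x).
Proof.
move=> yac zac a b a0 ab.
have bnd w : loc_abs_continuous w ->
    exists2 M, 0 <= M & forall x, a <= x <= b -> `|w x| <= M.
  move=> wac; have cab : {within `[a, b], continuous w}.
    apply: continuous_in_subspaceT => x; rewrite inE/= in_itv/= => /andP[ax _].
    by apply: loc_abs_continuous_cts => //; exact: lt_le_trans ax.
  have := compact_bounded (continuous_compact cab (@segment_compact _ a b)).
  move=> [N [_ HN]]; exists (`|N| + 1); first by rewrite addr_ge0.
  move=> x xab; apply: (HN (`|N| + 1)).
    by rewrite (le_lt_trans (ler_norm _))// ltrDl.
  by exists x => //=; rewrite in_itv.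
have [M M0 yM] := bnd _ yac; have [N N0 zN] := bnd _ zac.
apply: (@abs_continuousM _ _ _ _ _ (M + N)).
- by move=> x /yM h; rewrite (le_trans h)// lerDl.
- by move=> x /zN h; rewrite (le_trans h)// lerDr.
- exact: yac.
- exact: zac.
Qed.

Lemma C1_loc_abs_continuous y : (forall x, 0 < x -> derivable y x 1) ->
  (forall x, 0 < x -> {for x, continuous (derive1 y)}) -> loc_abs_continuous y.
Proof.
move=> dy cy a b a0 ab; apply: C1_abs_continuous => x /andP[ax _].
- by apply: dy; exact: lt_le_trans ax.
- by apply: cy; exact: lt_le_trans ax.
Qed.

Lemma loc_abs_continuous_ext y z : (forall x, 0 < x -> y x = z x) ->
  loc_abs_continuous y -> loc_abs_continuous z.
Proof.
move=> yz yac a b a0 ab e /(yac a b a0 ab)[d d0 yd]; exists d => // n u v uv tI uvd.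
apply: le_lt_trans (yd n u v uv tI uvd); rewrite le_eqVlt; apply/orP; left.
apply/eqP/eq_bigr => i _; have [au [uvi _]] := uv i.
by rewrite !yz//; [exact: lt_le_trans au|rewrite (lt_le_trans a0)// (le_trans au)].
Qed.

Lemma loc_abs_continuous_pow s c : loc_abs_continuous (fun x : R => c * x `^ s).
Proof.
have hd x : 0 < x -> has_deriv (fun x => c * x `^ s) x (c * (s * x `^ (s - 1))).
  by move=> x0; apply: has_derivZ; exact: has_deriv_powR.
apply: C1_loc_abs_continuous => x x0; first by case: (hd x x0).
apply: (@continuous_pos _ (fun x => c * (s * x `^ (s - 1)))) => //.
  by move=> t /hd[].
do 2 (apply: continuousM; first exact: cst_continuous).
exact: continuous_powR.
Qed.

Lemma weak_symbol_base : symbol_base weak_symbol.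
Proof.
split.
- move=> g y z yz [h1 h2 [h [h3 h4 h5]]]; split.
  + exact: loc_abs_continuous_ext h1.
  + exact: pow_bounded_ext h2.
  + exists h; split => //; apply: ae_mono h4 => x h4 x0.
    by apply: (has_deriv_pos x0 yz); exact: h4.
- move=> g y z [h1 h2 [h [h3 h4 h5]]] [h1' h2' [h' [h3' h4' h5']]]; split.
  + by move=> a b a0 ab; apply: abs_continuousD; [exact: h1|exact: h1'].
  + exact: pow_boundedD.
  + exists (fun x => h x + h' x); split; first exact: measurable_funD.
      apply: ae_mono (ae_and h4 h4') => x [d1 d2] x0.
      by apply: has_derivD; [exact: d1|exact: d2].
    move=> w e e0 mw w1 w2.
    have := integrableD _ (h5 w e e0 mw w1 w2) (h5' w e e0 mw w1 w2).
    move=> /(_ (measurable_itv _)); congr (_.-integrable _ _).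
    by apply/funext => x /=; rewrite -EFinD mulrDl.
- move=> g y s c [h1 h2 [h [h3 h4 h5]]]; split.
  + by apply: loc_abs_continuousM => //; exact: loc_abs_continuous_pow.
  + by rewrite addrC; apply: pow_boundedM h2; exact: pow_bounded_pow.
  + have my : measurable_fun pos y.
      by apply: measurable_pos => x x0; exact: loc_abs_continuous_cts.
    have mp := @measurable_powR_pos R.
    exists (fun x => c * (s * x `^ (s - 1)) * y x + c * x `^ s * h x); split.
    * by apply: measurable_funD; do ! apply: measurable_funM.
    * apply: ae_mono h4 => x h4 x0.
      by apply: has_derivM (h4 x0); apply: has_derivZ; exact: has_deriv_powR.
    * move=> w e e0 mw w1 w2.
      have b1 : pow_bounded (g + s - 1) (fun x => c * (s * x `^ (s - 1)) * y x).
        have := pow_boundedM (pow_bounded_pow (s - 1) (c * s)) h2.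
        by congr pow_bounded; [ring|apply/funext => x; rewrite mulrA].
      have m1 : measurable_fun pos (fun x => c * (s * x `^ (s - 1)) * y x).
        by do ! apply: measurable_funM.
      have i1 := pow_bounded_pairable m1 b1 e0 mw w1 w2.
      have i2 : mu.-integrable pos (EFin \o (fun x => h x * (c * x `^ s * w x))).
        apply: (h5 _ e e0).
        - by do ! apply: measurable_funM.
        - by have := pow_boundedM (pow_bounded_pow s c) w1; congr pow_bounded; ring.
        - by have := pow_boundedM (pow_bounded_pow s c) w2; congr pow_bounded; ring.
      have := integrableD _ i1 i2 => /(_ (measurable_itv _)); congr (_.-integrable _ _).
      by apply/funext => x /=; rewrite -EFinD; congr (_%:E); ring.
Qed.

Lemma symbol1_weak_symbol g y : symbol cont_symbol 1 g y -> weak_symbol g y.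
Proof.
move=> [[cy by'] dy [cy' by'']]; split => //; first exact: C1_loc_abs_continuous.
have my' := measurable_pos cy'; exists (derive1 y); split => //.
- by apply: aeW => x x0; split => //; exact: dy.
- exact: pow_bounded_pairable.
Qed.

Lemma ae_neq b : {ae mu, forall x, x != b}.
Proof.
exists [set b]; split => //; first exact: lebesgue_measure_set1.
by move=> x /= /negP/negPn/eqP.
Qed.

(** [h] need only agree almost everywhere with the density of
    [abs_continuous_FTC]; the end point [b], where nothing is known, is one more
    null set. *)
Lemma loc_abs_continuous_integral y h a b : loc_abs_continuous y ->
  ae_deriv y h -> 0 < a -> a < b ->
  (\int[mu]_(t in `]a, b]) (h t)%:E = (y b - y a)%:E)%E.
Proof.
move=> yac yh a0 ab.
have [g [_ gE gd]] := abs_continuous_FTC (ltW ab) (yac a b a0 (ltW ab)).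
rewrite -gE ?lexx ?(ltW ab)//; apply: ae_eq_integral_nonmeasurable.
apply: ae_mono (ae_and yh (ae_and gd (ae_neq b))) => x [hx [gx xb]] /=.
rewrite in_itv/= => /andP[ax xbl].
have axb : a < x < b by rewrite ax lt_neqAle xb.
have [_ <-] := gx axb.
by have [|_ ->] := hx; first exact: lt_trans ax.
Qed.

(** Integration by parts over [(0, oo)]: the two exponents [- g + e] and
    [- g - e] make the products integrable at 0 and at infinity and kill the
    boundary terms. *)
Lemma integration_by_parts_pos g e y z : 0 < e -> weak_symbol g y ->
  symbol cont_symbol 1 (- g + e) z -> symbol cont_symbol 1 (- g - e) z ->
  (\int[mu]_(x in pos) (derive1 y x * z x)%:E =
   - \int[mu]_(x in pos) (y x * derive1 z x)%:E)%E.
Proof.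
move=> e0 [yac by' [h [mh yh ph]]] [[cz bz1] dz [cz' bz1']] [[_ bz2] _ [_ bz2']].
have zac : loc_abs_continuous z by exact: C1_loc_abs_continuous.
have my : measurable_fun pos y.
  by apply: measurable_pos => x x0; exact: loc_abs_continuous_cts.
have i1 : mu.-integrable pos (EFin \o (fun x => h x * z x)).
  apply: (ph _ e e0); first exact: measurable_pos.
  - by move: bz1; congr pow_bounded; ring.
  - by move: bz2; congr pow_bounded; ring.
have i2 : mu.-integrable pos (EFin \o (fun x => y x * derive1 z x)).
  apply: (pow_bounded_pairable my by' e0); first exact: measurable_pos.
  - by move: bz1'; congr pow_bounded; ring.
  - by move: bz2'; congr pow_bounded; ring.
have -> : (\int[mu]_(x in pos) (derive1 y x * z x)%:E =
           \int[mu]_(x in pos) (h x * z x)%:E)%E.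
  apply: ae_eq_integral_nonmeasurable; apply: ae_mono yh => x yh /posP x0.
  by have [_ ->] := yh x0.
pose B x := y x * z x.
have Bh : ae_deriv B (fun x => h x * z x + y x * derive1 z x).
  apply: ae_mono yh => x yh x0; apply: has_derivM; first exact: yh.
  by split => //; exact: dz.
have Bac : loc_abs_continuous B by exact: loc_abs_continuousM.
have i12 : mu.-integrable pos (EFin \o (fun x => h x * z x + y x * derive1 z x)).
  have := integrableD _ i1 i2 => /(_ (measurable_itv _)).
  by congr (_.-integrable _ _); apply/funext => x /=; rewrite -EFinD.
have := integral_pos_primitive i12 (fun a b => loc_abs_continuous_integral Bac Bh).
have B0 : B x @[x --> 0^'+] --> (0 : R).
  apply: (pow_bounded_cvg0 e0); have := pow_boundedM by' bz1.
  by congr pow_bounded; ring.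
have By : B x @[x --> +oo] --> (0 : R).
  have e0' : - e < 0 by lra.
  apply: (pow_bounded_cvgy e0'); have := pow_boundedM by' bz2.
  by congr pow_bounded; ring.
move=> /(_ B0 By); under eq_integral do rewrite EFinD.
rewrite integralD_EFin// => s0.
have [r1 r1E] : exists r, (\int[mu]_(x in pos) (h x * z x)%:E = r%:E)%E.
  by exists (\int[mu]_(x in pos) (h x * z x))%R; rewrite fineK// integrable_fin_num.
have [r2 r2E] : exists r, (\int[mu]_(x in pos) (y x * derive1 z x)%:E = r%:E)%E.
  by exists (\int[mu]_(x in pos) (y x * derive1 z x))%R; rewrite fineK// integrable_fin_num.
have : (r1%:E + r2%:E = 0)%E by rewrite -r1E -r2E -s0.
rewrite r1E r2E -EFinD -EFinN => -[] /eqP.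
by rewrite addr_eq0 => /eqP ->.
Qed.

End WeakSymbol.

(** * Pointwise decay of functions with finite energy *)

Section EnergyBound.
Context {R : realType}.
Notation mu := (@lebesgue_measure R).
Notation pos := (`]0, +oo[%classic : set R).
Implicit Types (y z h u : R -> R) (t g s c e a b x : R) (j k m : nat).

Lemma loc_abs_continuous_ae_deriv y : loc_abs_continuous y -> ae_deriv y (derive1 y).
Proof.
move=> yac.
have H (n : nat) : {ae mu, forall x, n.+1%:R^-1 < x < n.+1%:R -> derivable y x 1}.
  have [nlt|nge] := ltP (n.+1%:R^-1 : R) n.+1%:R; last first.
    by apply: aeW => x /andP[h1 h2]; have := lt_trans h1 h2; rewrite ltNge nge.
  have [g [_ _ gd]] := abs_continuous_FTC (ltW nlt)
    (yac _ _ (harmonic_pos n) (ltW nlt)).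
  by apply: ae_mono gd => x gx /gx[].
have : {ae mu, forall x, forall n : nat, n.+1%:R^-1 < x < n.+1%:R -> derivable y x 1}.
  exact/ae_foralln.
apply: ae_mono => x hx x0; split => //.
have : pos x by exact/posP.
rewrite bigcup_itv_0y => -[n _ /=]; rewrite in_itv/= => /andP[h1 h2].
apply: (hx n.+1); apply/andP; split.
  by apply: le_lt_trans h1; rewrite lef_pV2 ?posrE ?ltr0Sn// ler_nat.
by apply: le_lt_trans h2 _; rewrite ltr_nat.
Qed.

(** The function [x `^ (t + 1) * y x ^+ 2] has an integrable derivative, hence
    it is bounded. *)
Lemma weighted_square_bound t y h : loc_abs_continuous y -> ae_deriv y h ->
  measurable_fun pos h ->
  mu.-integrable pos (EFin \o (fun x => y x ^+ 2 * x `^ t)) ->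
  mu.-integrable pos (EFin \o (fun x => h x ^+ 2 * x `^ (t + 2))) ->
  pow_bounded (- ((t + 1) / 2)) y.
Proof.
move=> yac yh mh iy ih.
pose G x := 1 * x `^ (t + 1) * (y x * y x).
pose H x := (t + 1) * x `^ t * (y x * y x) + x `^ (t + 1) * (h x * y x + y x * h x).
have Gac : loc_abs_continuous G.
  by apply: (loc_abs_continuousM (@loc_abs_continuous_pow _ (t + 1) 1));
    exact: loc_abs_continuousM.
have GH : ae_deriv G H.
  apply: ae_mono yh => x yh x0.
  apply: has_deriv_eq (has_derivM (has_derivZ 1 (has_deriv_powR (t + 1) x0))
    (has_derivM (yh x0) (yh x0))) _.
  by rewrite !mul1r addrK.
have my : measurable_fun pos y.
  by apply: measurable_pos => x x0; exact: loc_abs_continuous_cts.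
have mH : measurable_fun pos H.
  have mp := @measurable_powR_pos R.
  apply: measurable_funD; first by do ! apply: measurable_funM => //.
  by apply: measurable_funM => //; apply: measurable_funD; exact: measurable_funM.
have iH : mu.-integrable pos (EFin \o H).
    (* [|2 y h x| <= y^2 + (x h)^2] bounds the derivative of the weighted square *)
pose K : R := `|t + 1| + 1.
  have iK : mu.-integrable pos (EFin \o (fun x => K * (y x ^+ 2 * x `^ t) +
      h x ^+ 2 * x `^ (t + 2))).
    have iKy : mu.-integrable pos (EFin \o (fun x => K * (y x ^+ 2 * x `^ t))).
      rewrite (_ : EFin \o _ = (fun x => K%:E * (y x ^+ 2 * x `^ t)%:E)%E).
        exact: integrableZl.
      by apply/funext => x /=; rewrite EFinM.
    rewrite (_ : EFin \o _ = (fun x => (K * (y x ^+ 2 * x `^ t))%:E +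
      (h x ^+ 2 * x `^ (t + 2))%:E)%E).
      exact: integrableD.
    by apply/funext => x /=; rewrite EFinD.
  apply: le_integrable iK => //; first exact/measurable_EFinP.
  move=> x /posP x0 /=; rewrite lee_fin; apply: le_trans (ler_norm _).
  rewrite /H; set p := x `^ t; have p0 : 0 <= p by exact: powR_ge0.
  have -> : x `^ (t + 1) = p * x by rewrite powRDpos// powRr1// ltW.
  have -> : x `^ (t + 2) = p * x ^+ 2.
    by rewrite powRDpos//; congr (_ * _); rewrite -powR_mulrn// ltW.
  set T := t + 1; rewrite /K -/T.
  rewrite (le_trans (ler_normD _ _))//.
  have -> : `|T * p * (y x * y x)| = `|T| * (y x ^+ 2 * p).
    have yy0 : 0 <= y x * y x by rewrite -expr2 sqr_ge0.
    by rewrite [LHS]normrM [`|T * p|]normrM (ger0_norm p0) (ger0_norm yy0); ring.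
  have -> : p * x * (h x * y x + y x * h x) = p * (2 * (x * h x) * y x) by ring.
  rewrite normrM (ger0_norm p0) [in leRHS]mulrDl mul1r -addrA lerD//.
  have -> : y x ^+ 2 * p + h x ^+ 2 * (p * x ^+ 2) =
    p * (y x ^+ 2 + (x * h x) ^+ 2) by ring.
  apply: ler_wpM2l => //; rewrite ler_norml.
  have := sqr_ge0 (y x - x * h x); have := sqr_ge0 (y x + x * h x).
  by rewrite sqrrD sqrrB => h1 h2; apply/andP; split; nra.
pose M := (\int[mu]_(x in pos) `|H x|)%R.
have GM a b : 0 < a -> a < b -> `|G b - G a| <= M.
  move=> a0 ab.
  have sab : `]a, b] `<=` pos.
    by move=> x; rewrite /= !in_itv/= => /andP[ax _]; rewrite andbT; exact: lt_trans ax.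
  have iab : mu.-integrable `]a, b] (EFin \o H) by exact: integrableS iH.
  have <- : (\int[mu]_(x in `]a, b]) H x)%R = G b - G a.
    by rewrite /Rintegral (loc_abs_continuous_integral Gac GH a0 ab).
  apply: le_trans (le_normr_Rintegral _ iab) _ => //.
  have i1 : mu.-integrable pos (EFin \o (fun x => `|H x|)) by exact: integrable_norm.
  rewrite /M /Rintegral fine_le//.
  - by apply: integrable_fin_num => //; exact: integrableS i1.
  - exact: integrable_fin_num.
  - apply: ge0_subset_integral => //.
    by apply/measurable_EFinP; exact: measurableT_comp.
have M0 : 0 <= M by apply: Rintegral_ge0.
have G0 x : 0 <= G x.
  by rewrite /G mul1r mulr_ge0 ?powR_ge0// -expr2 sqr_ge0.
have Gb x : 0 < x -> G x <= G 1 + M.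
  move=> x0; have [x1|x1|->] := ltgtP x 1.
  - by have := GM _ _ x0 x1; rewrite ler_norml => /andP[]; lra.
  - by have := GM _ _ ltr01 x1; rewrite ler_norml => /andP[]; lra.
  - by rewrite lerDl.
exists (Num.sqrt (G 1 + M)) => x x0.
rewrite -(@ler_pXn2r _ 2)// ?nnegrE ?mulr_ge0 ?powR_ge0 ?sqrtr_ge0//.
rewrite exprMn sqr_sqrtr ?addr_ge0 ?G0//.
have -> : (x `^ (- ((t + 1) / 2))) ^+ 2 = (x `^ (t + 1))^-1.
  by rewrite -powR_mulrn ?powR_ge0// -powRrM -powRN; congr (_ `^ _); field.
rewrite ler_pdivlMr ?powR_gt0//; apply: le_trans (Gb x x0).
by rewrite real_normK ?num_real// /G mul1r expr2 mulrC.
Qed.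

Lemma in_wL2_integrable t y : in_wL 2 t y -> measurable_fun pos y /\
  mu.-integrable pos (EFin \o (fun x => y x ^+ 2 * x `^ t)).
Proof.
move=> [my]; rewrite /wLnorm => yfin; split => //.
have E x : `|y x| `^ 2 * x `^ t = y x ^+ 2 * x `^ t.
  by rewrite powR_mulrn// real_normK ?num_real.
apply/integrableP; split.
  apply/measurable_EFinP; apply: measurable_funM; first exact: measurable_funX.
  exact: measurable_powR_pos.
rewrite [X in (X < _)%E](_ : _ =
    \int[mu]_(x in pos) (`|y x| `^ 2 * x `^ t)%:E)%E; last first.
  by apply: eq_integral => x _; rewrite E /= ger0_norm// mulr_ge0 ?sqr_ge0 ?powR_ge0.
by apply: lty_poweRy yfin; rewrite invr_neq0.
Qed.

(** Below the top order the next derivative is continuous, so the function is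
    locally Lipschitz. *)
Lemma ACloc_abs_continuous m u j : ACloc m u -> (j <= m)%N ->
  loc_abs_continuous (derive1n j u).
Proof.
move=> [du uac]; rewrite leq_eqVlt => /predU1P[->//|jm].
apply: C1_loc_abs_continuous => x x0; first exact: du.
rewrite -[derive1 _]/(derive1n j.+1 u).
move: jm; rewrite leq_eqVlt => /predU1P[->|jm]; first exact: loc_abs_continuous_cts.
by apply: (@has_deriv_continuous _ _ _ (derive1n j.+2 u x)); split => //; exact: du.
Qed.

(** For consecutive orders of differentiation the weights of the space are
    exactly those that [weighted_square_bound] and
    [square_integrable_pairable] require. *)
Lemma inD_weak_symbol m a u : (0 < m)%N -> inD m a u ->
  symbol weak_symbol m.-1 (- ((a - 2 * m%:R + 1) / 2)) u.
Proof.
move=> m0 [uac uL _]; set be := (a - 2 * m%:R + 1) / 2.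
have ws j : (j < m)%N -> weak_symbol (- be - j%:R) (derive1n j u).
  move=> jm; have jm' : (j <= m.-1)%N by rewrite -ltnS prednK.
  have [mj ij] := in_wL2_integrable (uL j (ltnW jm)).
  have [mj1 ij1] := in_wL2_integrable (uL j.+1 jm).
  have jac := ACloc_abs_continuous uac jm'.
  have jd : ae_deriv (derive1n j u) (derive1n j.+1 u).
    exact: loc_abs_continuous_ae_deriv.
  split => //.
    have -> : - be - j%:R = - ((a - 2 * (m%:R - j%:R) + 1) / 2).
      by rewrite /be; field.
    apply: weighted_square_bound jac jd mj1 ij _.
    move: ij1; congr (_.-integrable _ (EFin \o _)); apply/funext => x.
    by congr (_ * _ `^ _); rewrite -natr1; ring.
  exists (derive1n j.+1 u); split => //; apply: square_integrable_pairable => //.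
  move: ij1; congr (_.-integrable _ (EFin \o _)); apply/funext => x.
  by congr (_ * _ `^ _); rewrite -natr1 /be; field.
have H k j : (k + j < m)%N -> symbol weak_symbol k (- be - j%:R) (derive1n j u).
  elim: k j => [|k IH] j kjm; first exact: ws.
  have jm : (j < m.-1)%N.
    by rewrite -ltnS prednK//; apply: leq_trans kjm; rewrite addSn ltnS ltnS leq_addl.
  split; first by apply: ws; apply: leq_ltn_trans kjm; rewrite leq_addl.
  - by move=> x x0; have [du _] := uac; exact: du.
  - have := IH j.+1; rewrite addnS -addSn => /(_ kjm).
    by rewrite -natr1 opprD addrA.
by have := H m.-1 0%N; rewrite addn0 prednK// => /(_ (leqnn _)); rewrite subr0.
Qed.

End EnergyBound.

(** * Quasi-derivatives and the energy form *)

Section QuasiDerivatives.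
Context {R : realType}.
Notation mu := (@lebesgue_measure R).
Notation pos := (`]0, +oo[%classic : set R).
Implicit Types (y z h u v : R -> R) (t g s c e x : R) (i j k m n : nat).
Variable a : R.

(** The radial Laplacian is [x^(-a) d x^a d], so its powers alternate the
    weights [x^a] and [x^(-a)] after each derivative. *)
Definition qexp i : R := if odd i then - a else a.

(** The quasi-derivatives: the successive stages in the computation of the
    iterated radial Laplacian.  The even ones are [laplacian_iter], the odd ones
    are [x^a] times the derivatives of the even ones. *)
Fixpoint qderiv i u : R -> R :=
  match i with
  | 0 => u
  | i'.+1 => fun x => x `^ (qexp i') * derive1 (qderiv i' u) x
  end.

Lemma qexpS i : qexp i.+1 = - qexp i.
Proof. by rewrite /qexp/=; case: (odd i); rewrite ?opprK. Qed.

Lemma qexp_double k : qexp k.*2 = a.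
Proof. by rewrite /qexp odd_double. Qed.

Lemma laplacian_iter_qderiv k u : laplacian_iter a k u = qderiv k.*2 u.
Proof.
elim: k => [//|k IH].
have -> : laplacian_iter a k.+1 u = laplacian a (laplacian_iter a k u) by [].
by rewrite IH; apply/funext => r; rewrite /laplacian doubleS /= qexpS qexp_double.
Qed.

Lemma derive1_qderiv i u x : 0 < x ->
  derive1 (qderiv i u) x = x `^ (- qexp i) * qderiv i.+1 u x.
Proof. by move=> x0 /=; rewrite mulrA -powRDpos// addNr powRr0 mul1r. Qed.

Lemma nabla_qderiv m u v x : 0 < x ->
  nabla a m u x * nabla a m v x * x `^ a =
  qderiv m u x * qderiv m v x * x `^ (qexp m).
Proof.
move=> x0; rewrite /nabla !laplacian_iter_qderiv.
have mE := odd_double_half m; case: ifPn => om; last first.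
  move: mE; set k := m./2; rewrite (negbTE om) add0n => mE.
  by rewrite -[in RHS]mE qexp_double.
move: mE; set k := m./2; rewrite om add1n => mE.
rewrite -[in RHS]mE !derive1_qderiv// qexpS qexp_double.
move: (qderiv k.*2.+1 u x) (qderiv k.*2.+1 v x) => U V.
have e : x `^ (- a) * x `^ a = 1 by rewrite -powRDpos// addNr powRr0.
transitivity (U * V * x `^ (- a) * (x `^ (- a) * x `^ a)); first ring.
by rewrite e mulr1.
Qed.

(** The odd quasi-derivatives carry a factor [x^a], which shifts their exponent
    by [a]. *)
Definition qshift i : R := if odd i then a else 0.

Lemma qshiftS i : qshift i.+1 = qshift i + qexp i.
Proof. by rewrite /qshift /qexp/=; case: (odd i) => /=; ring. Qed.

Lemma symbol_qderiv P (bP : symbol_base P) i k g u : symbol P (i + k) g u ->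
  symbol P k (g - i%:R + qshift i) (qderiv i u).
Proof.
elim: i k => [|i IH] k us.
  by rewrite subr0 /qshift addr0.
have := IH k.+1; rewrite addnS -addSn => /(_ us)[_ _ us'].
have := symbol_pow bP (qexp i) 1 us'; rewrite qshiftS -natr1 => us''.
have -> : g - (i%:R + 1) + (qshift i + qexp i) =
  g - i%:R + qshift i - 1 + qexp i by ring.
by apply: (symbol_ext bP) us'' => x _; rewrite mul1r.
Qed.

(** The forms interpolating between [int u (laplacian^(N/2) v) x^a], for
    [i = 0], and the same with [u] and [v] exchanged, for [i = N]; the energy
    form is the middle one. *)
Definition qpairing u v N i : \bar R :=
  (\int[mu]_(x in pos) (qderiv i u x * qderiv (N - i) v x * x `^ (qexp i))%:E)%E.

(** One integration by parts moves one quasi-derivative from [v] to [u]: the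
    weights [qexp] alternate, so they never have to be differentiated. *)
Lemma qpairingS n i g e u v : (i < n.*2)%N -> 0 < e ->
  weak_symbol (g - i%:R + qshift i) (qderiv i u) ->
  symbol cont_symbol n.*2 (- g + n.*2%:R - 1 - a + e) v ->
  symbol cont_symbol n.*2 (- g + n.*2%:R - 1 - a - e) v ->
  qpairing u v n.*2 i.+1 = (- qpairing u v n.*2 i)%E.
Proof.
move=> iN e0 us v1 v2.
pose j := (n.*2 - i.+1)%N.
have jN : (j + i.+1)%N = n.*2 by rewrite /j subnK.
have jiN : (n.*2 - i = j.+1)%N by rewrite -jN addnS -addSn addnK.
have jR : n.*2%:R = j%:R + i%:R + 1 :> R by rewrite -jN natrD -natr1 addrA.
have qj : qexp j = - qexp i.
  have : odd (j + i.+1) = false by rewrite jN odd_double.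
  by rewrite /qexp oddD/=; case: (odd j); case: (odd i); rewrite ?opprK.
have qsj : qshift j = a - qshift i.
  have : odd (j + i.+1) = false by rewrite jN odd_double.
  by rewrite /qshift oddD/=; case: (odd j); case: (odd i); rewrite ?subrr ?subr0.
have sv d : symbol cont_symbol n.*2 (- g + n.*2%:R - 1 - a + d) v ->
    symbol cont_symbol 1 (- (g - i%:R + qshift i) + d) (qderiv j v).
  move=> vs; have : symbol cont_symbol (j + 1) (- g + n.*2%:R - 1 - a + d) v.
    by apply: symbol_le vs; rewrite -jN leq_add2l.
  move/(symbol_qderiv (@cont_symbol_base R)); rewrite qsj jR.
  by congr symbol; ring.
have := integration_by_parts_pos e0 us (sv _ v1) (sv _ v2).
rewrite /qpairing -/j jiN => E.
rewrite -[LHS](_ :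
    \int[mu]_(x in pos) (derive1 (qderiv i u) x * qderiv j v x)%:E = _)%E; last first.
  apply: eq_integral => x; rewrite inE => /posP x0; congr (_%:E).
  by rewrite derive1_qderiv// qexpS; ring.
rewrite E; congr (- _)%E; apply: eq_integral => x; rewrite inE => /posP x0.
by congr (_%:E); rewrite derive1_qderiv// qj opprK; ring.
Qed.

Lemma qpairing_sign n k g e u v : (k <= n.*2)%N -> 0 < e ->
  (forall i, (i < k)%N -> weak_symbol (g - i%:R + qshift i) (qderiv i u)) ->
  symbol cont_symbol n.*2 (- g + n.*2%:R - 1 - a + e) v ->
  symbol cont_symbol n.*2 (- g + n.*2%:R - 1 - a - e) v ->
  qpairing u v n.*2 k = (((-1) ^+ k)%:E * qpairing u v n.*2 0)%E.
Proof.
move=> kn e0 us v1 v2; elim: k kn us => [|k IH] kn us; first by rewrite mul1e.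
rewrite (qpairingS kn e0 _ v1 v2); last exact: us.
rewrite IH; [|exact: ltnW|by move=> i ik; apply: us; exact: ltnW].
by rewrite exprS mulN1r EFinN mulNe.
Qed.

Lemma eq_laplacian u v x : 0 < x -> (forall t, 0 < t -> u t = v t) ->
  laplacian a u x = laplacian a v x.
Proof.
move=> x0 uv; rewrite /laplacian.
rewrite (@eq_derive1_pos _ _ (fun s => s `^ a * derive1 v s) x x0)// => t t0.
by rewrite (eq_derive1_pos t0 uv).
Qed.

Lemma eq_laplacian_iter k u v x : 0 < x -> (forall t, 0 < t -> u t = v t) ->
  laplacian_iter a k u x = laplacian_iter a k v x.
Proof.
move=> x0 uv; elim: k x x0 => [|k IH] x x0; first exact: uv.
exact: eq_laplacian.
Qed.

Lemma eq_opp_laplacian_iter k u v x : 0 < x -> (forall t, 0 < t -> u t = v t) ->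
  opp_laplacian_iter a k u x = opp_laplacian_iter a k v x.
Proof.
move=> x0 uv; elim: k x x0 => [|k IH] x x0; first exact: uv.
have S w : opp_laplacian_iter a k.+1 w x = - laplacian a (opp_laplacian_iter a k w) x by [].
by rewrite !S (eq_laplacian x0 IH).
Qed.

Lemma symbol_laplacian_iter P (bP : symbol_base P) i k g u :
  symbol P (i.*2 + k) g u -> symbol P k (g - i.*2%:R) (laplacian_iter a i u).
Proof.
move=> /(symbol_qderiv bP); rewrite laplacian_iter_qderiv.
by rewrite /qshift odd_double addr0.
Qed.

End QuasiDerivatives.

(** * Iterated inverse, signed powers and test functions *)

Section IteratedInverse.
Context {R : realType}.
Notation mu := (@lebesgue_measure R).
Notation pos := (`]0, +oo[%classic : set R).
Implicit Types (y z h u v w : R -> R) (t g s c e x : R) (i j k l m n : nat).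
Variable a : R.

Lemma laplacianZ g c w x : 0 < x -> symbol cont_symbol 2 g w ->
  laplacian a (fun t => c * w t) x = c * laplacian a w x.
Proof.
move=> x0 [_ dw [_ dw' _]]; rewrite /laplacian.
have hp := has_derivM (has_deriv_powR a x0) (conj (dw' x x0) erefl).
have [_ hE] := hp.
have [_ ->] : has_deriv (fun s => s `^ a * derive1 (fun t => c * w t) s) x
    (c * derive1 (fun s => s `^ a * derive1 w s) x).
  rewrite hE; apply: (has_deriv_pos x0 _ (has_derivZ c hp)) => t t0.
  have [_ ->] := has_derivZ c (conj (dw t t0) erefl).
  by rewrite mulrCA.
by rewrite mulrCA.
Qed.

Variables (n k : nat) (g : R) (h : R -> R).
Hypotheses (g1 : - (a + 1) < g) (g2 : g + n.*2%:R < 0) (hs : symbol cont_symbol k g h).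

Let exponent_gt i : - (a + 1) < g + i.*2%:R.
Proof. by have : 0 <= i.*2%:R :> R by []; move: g1; lra. Qed.

Let exponent_lt i : (i < n)%N -> g + i.*2%:R < -2.
Proof.
move=> iN; have iR : i.*2.+2%:R = i.*2%:R + 2 :> R by rewrite -addn2 natrD.
have : i.*2.+2%:R <= n.*2%:R :> R by rewrite ler_nat -doubleS leq_double.
by move: g2; lra.
Qed.

Lemma symbol_iter_radial_inv i : (i <= n)%N ->
  symbol cont_symbol (i.*2 + k) (g + i.*2%:R) (iter i (radial_inv a) h).
Proof.
elim: i => [|i IH] iN; first by rewrite addr0.
have iR : i.*2.+2%:R = i.*2%:R + 2 :> R by rewrite -addn2 natrD.
rewrite doubleS iR addrA iterS !addSn.
by apply: symbol_radial_inv; [|exact: exponent_lt|exact/IH/ltnW].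
Qed.

Lemma laplacian_iter_radial_inv_step i x : (i < n)%N -> 0 < x ->
  laplacian a (iter i.+1 (radial_inv a) h) x = - iter i (radial_inv a) h x.
Proof.
move=> iN x0; have is_ := symbol_iter_radial_inv (ltnW iN).
by rewrite iterS; apply: (laplacian_radial_inv _ _ is_) => //; exact: exponent_lt.
Qed.

Lemma opp_laplacian_iter_radial_inv j x : (j <= n)%N -> 0 < x ->
  opp_laplacian_iter a j (iter n (radial_inv a) h) x = iter (n - j) (radial_inv a) h x.
Proof.
elim: j x => [|j IH] x jn x0; first by rewrite subn0.
have -> : opp_laplacian_iter a j.+1 (iter n (radial_inv a) h) x =
  - laplacian a (opp_laplacian_iter a j (iter n (radial_inv a) h)) x by [].
have IHn := fun t => IH t (ltnW jn).
rewrite (eq_laplacian a x0 IHn) -(subnSK jn).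
by rewrite laplacian_iter_radial_inv_step ?opprK// ltn_subrL/= (leq_ltn_trans _ jn).
Qed.

Lemma laplacian_iter_radial_inv j x : (j <= n)%N -> 0 < x ->
  laplacian_iter a j (iter n (radial_inv a) h) x =
  (-1) ^+ j * iter (n - j) (radial_inv a) h x.
Proof.
elim: j x => [|j IH] x jn x0; first by rewrite subn0 mul1r.
have -> : laplacian_iter a j.+1 (iter n (radial_inv a) h) x =
  laplacian a (laplacian_iter a j (iter n (radial_inv a) h)) x by [].
have IHn := fun t => IH t (ltnW jn).
rewrite (eq_laplacian a x0 IHn) -(subnSK jn).
have lt1 : (n - j.+1 < n)%N by rewrite ltn_subrL/= (leq_ltn_trans _ jn).
have s2 : symbol cont_symbol 2 (g + (n - j.+1).+1.*2%:R)
    (iter (n - j.+1).+1 (radial_inv a) h).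
  by apply: symbol_le (symbol_iter_radial_inv lt1); rewrite doubleS.
by rewrite (laplacianZ _ x0 s2) laplacian_iter_radial_inv_step// exprS mulrN mulN1r mulNr.
Qed.

Lemma iter_radial_inv_integral i r : (i < n)%N -> 0 < r ->
  ((iter i.+1 (radial_inv a) h r)%:E = \int[mu]_(t in `]r, +oo[) ((t `^ (- a))%:E *
     \int[mu]_(s in `]0%R, t[) (iter i (radial_inv a) h s * s `^ a)%:E))%E.
Proof.
move=> iN r0; have is_ := symbol_iter_radial_inv (ltnW iN).
by rewrite iterS; apply: (radial_inv_integral _ _ is_) => //; exact: exponent_lt.
Qed.

End IteratedInverse.

Section Power.
Context {R : realType}.
Notation mu := (@lebesgue_measure R).
Notation pos := (`]0, +oo[%classic : set R).
Implicit Types (y z h u v w : R -> R) (t g s c e p x : R).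

Lemma continuous_norm_powR0 p : 0 < p -> {for 0, continuous (fun s : R => `|s| `^ p)}.
Proof.
move=> p0; rewrite /prop_for /continuous_at normr0 powR0 ?gt_eqF//.
apply/cvgrPdist_lt => e e0; near=> s.
rewrite sub0r normrN ger0_norm ?powR_ge0//.
have h : `|s| < e `^ p^-1.
  have : `|0 - s| < e `^ p^-1.
    by near: s; apply: cvgr_dist_lt; [exact: cvg_id|exact: powR_gt0].
  by rewrite sub0r normrN.
have := @gt0_ltr_powR R p p0 _ _ _ _ h.
rewrite !nnegrE powR_ge0 normr_ge0 => /(_ isT isT).
by rewrite -powRrM mulVf ?gt_eqF// powRr1// ltW.
Unshelve. all: by end_near. Qed.

Lemma has_deriv_signed_power p s : 0 < p ->
  has_deriv (fun t => `|t| `^ p * t) s ((p + 1) * `|s| `^ p).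
Proof.
move=> p0.
have posc x : 0 < x -> has_deriv (fun t => `|t| `^ p * t) x ((p + 1) * `|x| `^ p).
  move=> x0; rewrite ger0_norm ?ltW//.
  apply: (has_deriv_pos x0 (f := fun t => t `^ (p + 1))).
    by move=> t t0; rewrite powRDpos// powRr1 ?ltW// ger0_norm// ltW.
  apply: has_deriv_eq (has_deriv_powR (p + 1) x0) _.
  by rewrite addrK.
have [s0|s0|->] := ltgtP s 0; last 1 first.
- rewrite normr0 powR0 ?gt_eqF// mulr0; apply: has_deriv_is.
  apply/is_derive1_caratheodory; exists (fun t => `|t| `^ p); split.
  + by move=> z; rewrite mulr0 !subr0.
  + exact: continuous_norm_powR0.
  + by rewrite normr0 powR0// gt_eqF.
- have s0' : 0 < - s by rewrite oppr_gt0.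
  have idN : has_deriv (fun t : R => - t) s (-1).
    by apply: has_derivN; apply: has_deriv_is; exact: is_derive_id.
  have E : (fun t : R => - (`|- t| `^ p * - t)) = (fun t => `|t| `^ p * t).
    by apply/funext => t; rewrite normrN mulrN opprK.
  have := has_derivN (has_deriv_comp idN (posc _ s0')); rewrite E normrN.
  by move/has_deriv_eq; apply; rewrite mulrN1 opprK.
- exact: posc.
Qed.

Lemma pow_bounded_norm_powR g p y : 0 <= p -> pow_bounded g y ->
  pow_bounded (g * p) (fun x => `|y x| `^ p).
Proof.
move=> p0 /pow_bounded_ge0[C C0 yC]; exists (C `^ p) => x x0.
rewrite ger0_norm ?powR_ge0// powRrM -powRM ?powR_ge0//.
by apply: ge0_ler_powR => //; rewrite ?nnegrE ?mulr_ge0 ?powR_ge0// yC.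
Qed.

(** A continuous function that is positive at a point exceeds half its value
    there on an interval, which contributes to the integral. *)
Lemma integral_pos_eq0 h : (forall x, 0 < x -> {for x, continuous h}) ->
  (forall x, 0 < x -> 0 <= h x) -> (\int[mu]_(x in pos) (h x)%:E = 0)%E ->
  forall x, 0 < x -> h x = 0.
Proof.
move=> hc h0 ih x x0; apply/eqP/negPn/negP => hx.
have hx0 : 0 < h x by rewrite lt_neqAle eq_sym hx h0.
have /cvgrPdist_lt /(_ (h x / 2)) : h t @[t --> x] --> h x by exact: hc.
rewrite divr_gt0// => /(_ isT)[d /= d0 hd].
pose e := Num.min d (x / 2); have e0 : 0 < e by rewrite lt_min d0 divr_gt0.
have ex : e <= x / 2 by rewrite ge_min lexx orbT.
pose J := (`]x - e, x + e[%classic : set R).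
have Jpos : J `<=` pos.
  by move=> t; rewrite /J /= !in_itv/= andbT => /andP[]; lra.
have Jh t : J t -> h x / 2 <= h t.
  rewrite /J /= in_itv/= => /andP[t1 t2].
  have : `|h x - h t| < h x / 2.
    apply: hd => /=; rewrite lt_min in e0; apply: (@lt_le_trans _ _ e).
      by rewrite ltr_norml; apply/andP; lra.
    by rewrite ge_min lexx.
  by rewrite ltr_norml => /andP[]; lra.
have mJ : measurable J by exact: measurable_itv.
have mh : measurable_fun pos h by exact: measurable_pos.
have : (\int[mu]_(t in J) (h x / 2)%:E <= \int[mu]_(t in pos) (h t)%:E)%E.
  apply: (@le_trans _ _ (\int[mu]_(t in J) (h t)%:E)%E).
    apply: ge0_le_integral => //.
    - by move=> t _; rewrite lee_fin divr_ge0// ltW.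
    - by apply/measurable_EFinP; exact: measurable_funS mh.
  apply: ge0_subset_integral => //; first exact/measurable_EFinP.
  by move=> t /posP t0; rewrite lee_fin h0.
have muJ : mu J = (x + e - (x - e))%:E.
  rewrite /J lebesgue_measure_itv/= lte_fin ifT ?EFinB//; lra.
rewrite ih integral_cst// [X in (_ * X)%E]muJ -EFinM lee_fin leNgt => /negP; apply.
by rewrite mulr_gt0 ?divr_gt0//; lra.
Qed.

End Power.

Section TestFunction.
Context {R : realType}.
Notation mu := (@lebesgue_measure R).
Notation pos := (`]0, +oo[%classic : set R).
Implicit Types (v : R -> R) (e t : R) (m j : nat).

Lemma integrable_in_wL2 t v : measurable_fun pos v ->
  mu.-integrable pos (EFin \o (fun x => v x ^+ 2 * x `^ t)) -> in_wL 2 t v.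
Proof.
move=> mv /integrableP[_ iv]; split => //; apply: poweR_lty.
apply: le_lt_trans iv; rewrite le_eqVlt; apply/orP; left; apply/eqP.
apply: eq_integral => x _ /=.
by rewrite powR_mulrn// real_normK ?num_real// ger0_norm// mulr_ge0 ?sqr_ge0 ?powR_ge0.
Qed.

Lemma derive1n_cst0 m : derive1n m (fun=> 0 : R) = (fun=> 0 : R).
Proof.
by elim: m => [//|m IH]; rewrite derive1nS IH; apply/funext => x; exact: derive1_cst.
Qed.

(** Both exponents are needed: one gives the integrability of the weighted
    squares near 0, the other one gives it near infinity.  The function lies in
    the space before completion, and a constant sequence approximates it. *)
Lemma symbol_inD m al e v : (0 < m)%N -> 0 < e ->
  let b := (al - 2 * m%:R + 1) / 2 in 0 < b ->
  symbol cont_symbol m (- b + e) v -> symbol cont_symbol m (- b - e) v ->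
  inD m al v.
Proof.
move=> m0 e0 b b0 v1 v2.
have bE : al = 2 * b + 2 * m%:R - 1 by rewrite /b; field.
have sj j : (j <= m)%N -> cont_symbol (- b + e - j%:R) (derive1n j v) /\
    cont_symbol (- b - e - j%:R) (derive1n j v).
  move=> jm; have h1 := symbolW (symbol_derive1n jm v1).
  by have h2 := symbolW (symbol_derive1n jm v2).
have wl j : (j <= m)%N -> in_wL 2 (al - 2 * (m%:R - j%:R)) (derive1n j v).
  move=> /sj[[cv b1] [_ b2]]; have mv := measurable_pos cv.
  apply: integrable_in_wL2 => //.
  set t := al - _; have bp := @pow_bounded_powR R t.
  apply: (@integrable_pos_bounded _ _ (2 * e)); first lra.
  - by apply: measurable_funM; [exact: measurable_funX|exact: measurable_powR_pos].
  - have := pow_boundedM (pow_boundedM b1 b1) bp.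
    by congr pow_bounded; rewrite /t bE; ring.
  - have := pow_boundedM (pow_boundedM b2 b2) bp.
    by congr pow_bounded; rewrite /t bE; ring.
have acv : ACloc m.-1 v.
  split.
    move=> j r jm r0; apply: (symbol_derivable _ v1 r0).
    by apply: leq_trans jm _; exact: leq_pred.
  have := symbol_derive1n (leq_pred m) v1.
  have -> : (m - m.-1 = 1)%N by rewrite -{1}(prednK m0) subSnn.
  by move=> /symbol1_weak_symbol[].
split => //; exists (fun=> v) => [_|].
  split => //.
    move=> j jm; have [_ [_ bj]] := sj j (ltnW jm).
    apply: pow_bounded_cvgy bj; have : 0 <= j%:R :> R by exact: ler0n.
    by lra.
  by have := wl m (leqnn m); rewrite subrr mulr0 subr0.
have -> : (fun r => v r - v r) = (fun=> 0) by apply/funext => r; rewrite subrr.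
rewrite derive1n_cst0 /wLnorm integral0_eq; last first.
  by move=> x _; rewrite normr0 powR0 ?mul0r.
by rewrite poweR0r ?invr_neq0//; exact: cvg_cst.
Qed.

End TestFunction.

(** * The integral representation of weak solutions *)

Section Representation.
Context {R : realType}.
Notation mu := (@lebesgue_measure R).
Notation pos := (`]0, +oo[%classic : set R).
Implicit Types (u v w h : R -> R) (e x : R) (j k : nat).
Variables (m : nat) (al : R).
Hypotheses (m0 : (0 < m)%N) (b0 : 0 < al - 2 * m%:R + 1).

Let b := (al - 2 * m%:R + 1) / 2.

Let bp : 0 < b. Proof. by rewrite divr_gt0. Qed.

Let alE : al = 2 * b + 2 * m%:R - 1. Proof. by rewrite /b; field. Qed.

Let m2E : m.*2%:R = 2 * m%:R :> R. Proof. by rewrite -muln2 natrM mulrC. Qed.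

Lemma crit_exp_gt2 : 0 < crit_exp m al - 2.
Proof.
have -> : crit_exp m al - 2 = 2 * m%:R / b.
  by rewrite /crit_exp {1}/b; field; rewrite gt_eqF.
by rewrite divr_gt0// mulr_gt0// ltr0n.
Qed.

(** This identity makes [-b] the critical exponent: it says that
    [(-b) * (crit_exp - 1) = - b - 2 m]. *)
Lemma mul_crit_exp : b * (crit_exp m al - 2) = 2 * m%:R.
Proof. by rewrite /crit_exp /b; field; rewrite gt_eqF. Qed.

Lemma cont_symbol_crit_nonlin u : cont_symbol (- b) u ->
  cont_symbol (- b - m.*2%:R) (crit_nonlin m al u).
Proof.
move=> [cu bu]; have p0 := crit_exp_gt2; split.
  move=> x x0; apply: (@continuous_comp _ _ _ u (fun s => `|s| `^ (crit_exp m al - 2) * s)).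
    exact: cu.
  exact: has_deriv_continuous (has_deriv_signed_power (u x) p0).
have := pow_boundedM (pow_bounded_norm_powR (ltW p0) bu) bu.
by rewrite mulNr mul_crit_exp m2E addrC.
Qed.

(** The operator [T^m] that inverts [(- Delta_alpha)^m]. *)
Definition solution_operator h := iter m (radial_inv al) h.

Lemma symbol_solution_operator h e : - b < e -> e < b ->
  cont_symbol (- b - m.*2%:R + e) h ->
  symbol cont_symbol m.*2 (- b + e) (solution_operator h).
Proof.
move=> e1 e2 hs.
have g1 : - (al + 1) < - b - m.*2%:R + e by rewrite alE m2E; lra.
have g2 : - b - m.*2%:R + e + m.*2%:R < 0 by lra.
have := symbol_iter_radial_inv (k := 0) g1 g2 hs (leqnn m).
by rewrite addn0; congr symbol; ring.
Qed.

Lemma laplacian_solution_operator h e x : - b < e -> e < b ->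
  cont_symbol (- b - m.*2%:R + e) h -> 0 < x ->
  laplacian_iter al m (solution_operator h) x = (-1) ^+ m * h x.
Proof.
move=> e1 e2 hs x0.
have g1 : - (al + 1) < - b - m.*2%:R + e by rewrite alE m2E; lra.
have g2 : - b - m.*2%:R + e + m.*2%:R < 0 by lra.
have := laplacian_iter_radial_inv (k := 0) g1 g2 hs (leqnn m) x0.
by rewrite subnn.
Qed.

Lemma integral_sign h : mu.-integrable pos (EFin \o h) ->
  (\int[mu]_(x in pos) ((-1) ^+ m * h x)%:E =
   ((-1) ^+ m)%:E * \int[mu]_(x in pos) (h x)%:E)%E.
Proof.
by move=> hi; rewrite -integralZl.
Qed.

Lemma signE (r : \bar R) : (((-1) ^+ m)%:E * (((-1) ^+ m)%:E * r) = r)%E.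
Proof. by rewrite muleA -EFinM -exprMn mulrNN mulr1 expr1n mul1e. Qed.

Section OneTest.
Variables (e : R) (phi : R -> R).
Hypotheses (e0 : 0 < e) (eb : e < b).
Hypotheses (phi1 : cont_symbol (- b - m.*2%:R + e) phi)
           (phi2 : cont_symbol (- b - m.*2%:R - e) phi).

Let v := solution_operator phi.

Let v1 : symbol cont_symbol m.*2 (- b + e) v.
Proof. by apply: symbol_solution_operator => //; move: e0 bp; lra. Qed.

Let v2 : symbol cont_symbol m.*2 (- b - e) v.
Proof. by apply: symbol_solution_operator => //; move: e0 eb; lra. Qed.

Lemma inD_solution_operator : inD m al v.
Proof.
have mm : (m <= m.*2)%N by rewrite -addnn leq_addl.
by apply: (symbol_inD m0 e0 bp); [exact: symbol_le v1|exact: symbol_le v2].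
Qed.

Let lapv x : 0 < x -> laplacian_iter al m v x = (-1) ^+ m * phi x.
Proof.
by move=> x0; apply: (laplacian_solution_operator (e := e)) => //; move: e0 bp; lra.
Qed.

Let dE : - (- b) + m.*2%:R - 1 - al = - b.
Proof. by rewrite alE m2E; ring. Qed.

Lemma integrable_test w : cont_symbol (- b) w ->
  mu.-integrable pos (EFin \o (fun x => w x * phi x * x `^ al)).
Proof.
move=> [cw bw]; have [cphi b1] := phi1; have [_ b2] := phi2.
have ba := @pow_bounded_powR R al.
apply: (integrable_pos_bounded e0).
- apply: measurable_funM; last exact: measurable_powR_pos.
  by apply: measurable_funM; exact: measurable_pos.
- have := pow_boundedM (pow_boundedM bw b1) ba.
  by congr pow_bounded; rewrite m2E [in LHS]alE; ring.
- have := pow_boundedM (pow_boundedM bw b2) ba.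
  by congr pow_bounded; rewrite m2E [in LHS]alE; ring.
Qed.

Let qpairing0 w : cont_symbol (- b) w ->
  qpairing al w v m.*2 0 =
  (((-1) ^+ m)%:E * \int[mu]_(x in pos) (w x * phi x * x `^ al)%:E)%E.
Proof.
move=> ws; rewrite -(integral_sign (integrable_test ws)).
apply: eq_integral => x; rewrite inE => /posP x0; congr (_%:E).
rewrite subn0 -laplacian_iter_qderiv lapv//= /qexp/=; ring.
Qed.

(** The energy form is the middle [qpairing], reached from the one at [i = 0] by
    [m] integrations by parts; the last of them involves the derivative of
    order [m] of [u], which exists almost everywhere. *)
Lemma energy_test u : symbol weak_symbol m.-1 (- b) u -> cont_symbol (- b) u ->
  (\int[mu]_(x in pos) (nabla al m u x * nabla al m v x * x `^ al)%:E =
   \int[mu]_(x in pos) (u x * phi x * x `^ al)%:E)%E.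
Proof.
move=> us uc.
have := @qpairing_sign R al m m (- b) e u v.
rewrite dE -addnn leq_addl => /(_ isT e0 _ _ _)/=; rewrite addnn => H.
rewrite [RHS](_ : _ = qpairing al u v m.*2 m).
  apply: eq_integral => x; rewrite inE => /posP x0; congr (_%:E).
  by rewrite nabla_qderiv// -addnn addnK.
rewrite H//.
  by rewrite (qpairing0 uc) signE.
move=> i im; apply: (@symbolW _ weak_symbol 0).
apply: symbol_qderiv; first exact: weak_symbol_base.
by apply: symbol_le us; rewrite addn0 -ltnS prednK.
Qed.

(** The symmetry of [T^m]: all the [2 m] derivatives are moved from [v] to
    [T^m h]. *)
Lemma dual_test h : cont_symbol (- b - m.*2%:R) h ->
  (\int[mu]_(x in pos) (h x * v x * x `^ al)%:E =
   \int[mu]_(x in pos) (solution_operator h x * phi x * x `^ al)%:E)%E.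
Proof.
move=> hs; set w := solution_operator h.
have hs0 : cont_symbol (- b - m.*2%:R + 0) h by rewrite addr0.
have nb : - b < 0 by move: bp; lra.
have ws : symbol cont_symbol m.*2 (- b) w.
  by have := symbol_solution_operator nb bp hs0; rewrite addr0.
have wc := symbolW ws.
have lapw x : 0 < x -> laplacian_iter al m w x = (-1) ^+ m * h x.
  by move=> x0; exact: (laplacian_solution_operator nb bp hs0).
have := @qpairing_sign R al m m.*2 (- b) e w v.
rewrite dE leqnn => /(_ isT e0 _ _ _)/= H.
have {H} H : qpairing al w v m.*2 m.*2 = qpairing al w v m.*2 0.
  rewrite H//; first by rewrite -mul2n exprM sqrrN expr1n expr1n mul1e.
  move=> i im; apply: symbol1_weak_symbol.
  apply: symbol_qderiv; first exact: cont_symbol_base.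
  by apply: symbol_le ws; rewrite addn1.
have ih : mu.-integrable pos (EFin \o (fun x => h x * v x * x `^ al)).
  have [ch bh] := hs; have [cv bv1] := symbolW v1; have [_ bv2] := symbolW v2.
  have ba := @pow_bounded_powR R al.
  apply: (integrable_pos_bounded e0).
  - apply: measurable_funM; last exact: measurable_powR_pos.
    by apply: measurable_funM; exact: measurable_pos.
  - have := pow_boundedM (pow_boundedM bh bv1) ba.
    by congr pow_bounded; rewrite m2E [in LHS]alE; ring.
  - have := pow_boundedM (pow_boundedM bh bv2) ba.
    by congr pow_bounded; rewrite m2E [in LHS]alE; ring.
have E : qpairing al w v m.*2 m.*2 =
    (((-1) ^+ m)%:E * \int[mu]_(x in pos) (h x * v x * x `^ al)%:E)%E.
  rewrite -(integral_sign ih).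
  apply: eq_integral => x; rewrite inE => /posP x0; congr (_%:E).
  by rewrite subnn -laplacian_iter_qderiv lapw//= qexp_double; ring.
by rewrite -[LHS]signE -E H (qpairing0 wc) signE.
Qed.

End OneTest.

(** The weak solution and [T^m f] have the same integral against
    [phi x^alpha] for every admissible [phi]; one takes for [phi] their
    difference, multiplied by a positive factor that gives it the required
    behaviour at both ends. *)
Lemma solution_representation u : inD m al u -> weak_solution m al u ->
  cont_symbol (- b) u /\
  forall x, 0 < x -> u x = solution_operator (crit_nonlin m al u) x.
Proof.
move=> uD uw.
have us := inD_weak_symbol m0 uD.
have uc : cont_symbol (- b) u.
  have [uac ub _] := symbolW us; split => // x x0.
  exact: loc_abs_continuous_cts.
split => //; set f := crit_nonlin m al u; set w := solution_operator f.
have fs : cont_symbol (- b - m.*2%:R) f by exact: cont_symbol_crit_nonlin.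
have nb : - b < 0 by move: bp; lra.
have wc : cont_symbol (- b) w.
  have fs0 : cont_symbol (- b - m.*2%:R + 0) f by rewrite addr0.
  by have := symbolW (symbol_solution_operator nb bp fs0); rewrite addr0.
pose e := b / 2; have [e0 eb] : 0 < e /\ e < b by split; rewrite /e; move: bp; lra.
(* [kap] is at most [x^e] and at most [x^(-e)] *)
pose kap (x : R) := (x `^ e + x `^ (- e))^-1.
have kap_gt0 x : 0 < x -> 0 < kap x.
  by move=> x0; rewrite invr_gt0 addr_gt0// powR_gt0.
have kapc x : 0 < x -> {for x, continuous kap}.
  move=> x0; apply: continuousV; first by rewrite gt_eqF// addr_gt0// powR_gt0.
  by apply: continuousD; exact: continuous_powR.
have kapb s : s = e \/ s = - e -> cont_symbol s kap.
  move=> se; split; first exact: kapc.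
  exists 1 => x x0; rewrite mul1r ger0_norm; last exact/ltW/kap_gt0.
  rewrite -[x `^ s]invrK -powRN lef_pV2 ?posrE ?addr_gt0 ?powR_gt0//.
  by case: se => ->; rewrite ?opprK ?lerDl ?lerDr powR_ge0.
pose d x := u x - w x.
have ds : cont_symbol (- b) d.
  have wN := symbolZ (k := 0) (@cont_symbol_base R) (-1) wc.
  apply: (base_ext (@cont_symbol_base R)) (base_add (@cont_symbol_base R) uc wN).
  by move=> x x0; rewrite mulN1r.
pose phi x := 1 * x `^ (- m.*2%:R) * (d x * kap x).
have phis s : s = e \/ s = - e -> cont_symbol (- b - m.*2%:R + s) phi.
  move=> /kapb[ck bk]; have [cd bd] := ds; rewrite addrAC.
  apply: (base_pow (@cont_symbol_base R)); split; last exact: pow_boundedM.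
  by move=> x x0; apply: continuousM; [exact: cd|exact: ck].
have phi1 := phis _ (or_introl erefl); have phi2 := phis _ (or_intror erefl).
(* the test function is [T^m phi] *)
have := uw _ (inD_solution_operator e0 eb phi1 phi2).
rewrite (energy_test e0 eb phi1 phi2 us uc) (dual_test e0 eb phi1 phi2 fs) -/w => E.
pose q x := d x * phi x * x `^ al.
have q0 : (\int[mu]_(x in pos) (q x)%:E = 0)%E.
  rewrite (_ : (fun x => (q x)%:E) =
    (fun x => (u x * phi x * x `^ al)%:E - (w x * phi x * x `^ al)%:E)%E); last first.
    by apply/funext => x; rewrite -EFinB; congr (_%:E); rewrite /q /d; ring.
  have iu := integrable_test e0 phi1 phi2 uc.
  have iw := integrable_test e0 phi1 phi2 wc.
  rewrite integralB_EFin// E subee//; exact: integrable_fin_num.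
have qc x : 0 < x -> {for x, continuous q}.
  move=> x0; have [cd _] := ds; have [cphi _] := phi1.
  apply: continuousM; last exact: continuous_powR.
  by apply: continuousM; [exact: cd|exact: cphi].
have qE x : q x = d x ^+ 2 * (x `^ (- m.*2%:R) * kap x * x `^ al).
  by rewrite /q /phi; ring.
have qge0 x : 0 < x -> 0 <= q x.
  move=> x0; rewrite qE mulr_ge0 ?sqr_ge0// !mulr_ge0 ?powR_ge0//.
  exact/ltW/kap_gt0.
move=> x x0; have := integral_pos_eq0 qc qge0 q0 x0.
have wpos : 0 < x `^ (- m.*2%:R) * kap x * x `^ al.
  by rewrite !mulr_gt0 ?powR_gt0// kap_gt0.
move/eqP; rewrite qE mulf_eq0 (gt_eqF wpos) orbF.
by rewrite sqrf_eq0 subr_eq0 => /eqP.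
Qed.

End Representation.

(** * The theorem *)

Theorem theorem1p1 (R : realType) (m : nat) (alpha : R) (u : R -> R)
    (hm : (1 <= m)%N) (halpha : -1 < alpha)
    (hcrit : 0 < alpha - 2 * m%:R + 1)
    (hu : inD m alpha u) (hweak : weak_solution m alpha u) :
  Ck_pos (2 * m) u /\
  (forall r, 0 < r ->
    opp_laplacian_iter alpha m u r = crit_nonlin m alpha u r) /\
  (forall j, (j < m)%N ->
    r `^ alpha * laplacian_iter alpha j u r @[r --> 0^'+] --> (0 : R) /\
    r `^ alpha * derive1 (laplacian_iter alpha j u) r @[r --> 0^'+] --> (0 : R)) /\
  (forall j, (j <= m)%N ->
    (forall r, 0 < r -> derivable (laplacian_iter alpha j u) r 1) /\
    laplacian_iter alpha j u r @[r --> +oo] --> (0 : R) /\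
    derive1 (laplacian_iter alpha j u) r @[r --> +oo] --> (0 : R)) /\
  (forall j r, (j < m)%N -> 0 < r ->
    ((opp_laplacian_iter alpha j u r)%:E =
     \int[@lebesgue_measure R]_(t in `]r, +oo[)
       ((t `^ (- alpha))%:E *
        \int[@lebesgue_measure R]_(s in `]0%R, t[)
          (opp_laplacian_iter alpha j.+1 u s * s `^ alpha)%:E))%E).
Proof.
set b := (alpha - 2 * m%:R + 1) / 2.
have b0 : 0 < b by rewrite divr_gt0.
have aE : alpha = 2 * b + 2 * m%:R - 1 by rewrite /b; field.
have m2E : m.*2%:R = 2 * m%:R :> R by rewrite -muln2 natrM mulrC.
set f := crit_nonlin m alpha u.
have [uc uE] := solution_representation hm hcrit hu hweak.
have fs : cont_symbol (- b - m.*2%:R) f by exact: cont_symbol_crit_nonlin.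
(* the exponents met by [T^i f], for [i < m], are between these bounds *)
have g1 : - (alpha + 1) < - b - m.*2%:R by rewrite aE m2E; lra.
have g2 : - b - m.*2%:R + m.*2%:R < 0 by lra.
have us : symbol cont_symbol m.*2 (- b) u.
  apply: (symbol_ext (@cont_symbol_base R)) => [x x0|].
    by rewrite uE.
  have := symbol_iter_radial_inv (k := 0) g1 g2 fs (leqnn m).
  by rewrite addn0 subrK.
have opp_lap j r : (j <= m)%N -> 0 < r ->
    opp_laplacian_iter alpha j u r = iter (m - j) (radial_inv alpha) f r.
  move=> jm r0; rewrite (eq_opp_laplacian_iter alpha j r0 uE).
  exact: (opp_laplacian_iter_radial_inv (k := 0) g1 g2 fs).
have lap_symbol j : (j < m)%N ->
    symbol cont_symbol 1 (- b - j.*2%:R) (laplacian_iter alpha j u).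
  move=> jm; apply: (symbol_laplacian_iter alpha (@cont_symbol_base R)).
  by apply: symbol_le us; rewrite addn1 ltn_double.
have j2E j : j.*2%:R = 2 * j%:R :> R by rewrite -muln2 natrM mulrC.
split; [|split; [|split; [|split]]].
- split.
  + by move=> j r; rewrite mul2n => jm r0; exact: symbol_derivable us r0.
  + move=> r r0; rewrite mul2n.
    by have [c _] := symbolW (symbol_derive1n (leqnn _) us); exact: c.
- by move=> r r0; rewrite opp_lap// subnn.
- move=> j jm; have [[_ b1] _ [_ b2]] := lap_symbol j jm.
  have jm' : j%:R + 1 <= m%:R :> R by rewrite natr1 ler_nat.
  have j0 : 0 <= j%:R :> R by exact: ler0n.
  split.
  + by apply: pow_bounded_cvg0 (pow_boundedM (pow_bounded_powR alpha) b1); rewrite j2E aE; lra.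
  + by apply: pow_bounded_cvg0 (pow_boundedM (pow_bounded_powR alpha) b2); rewrite j2E aE; lra.
- move=> j jm; have j0 : 0 <= j%:R :> R by exact: ler0n.
  suff [dj [b1 b2]] : (forall r, 0 < r -> derivable (laplacian_iter alpha j u) r 1) /\
      pow_bounded (- b - j.*2%:R) (laplacian_iter alpha j u) /\
      pow_bounded (- b - j.*2%:R - 1) (derive1 (laplacian_iter alpha j u)).
    split=> //; split.
    + by apply: pow_bounded_cvgy b1; rewrite j2E; lra.
    + by apply: pow_bounded_cvgy b2; rewrite j2E; lra.
  (* for [j = m] the iterated Laplacian is the nonlinearity up to sign, and it is
     differentiable because [s |-> |s|^p s] is *)
  move: jm; rewrite leq_eqVlt => /predU1P[->|jm]; last first.
    by have [[_ b1] dj [_ b2]] := lap_symbol j jm.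
  set p := crit_exp m alpha - 2.
  have p0 : 0 < p by exact: crit_exp_gt2.
  have lapE r : 0 < r -> (-1) ^+ m * f r = laplacian_iter alpha m u r.
    move=> r0; rewrite (eq_laplacian_iter alpha m r0 uE).
    by rewrite (laplacian_iter_radial_inv (k := 0) g1 g2 fs)// subnn.
  have [_ du [_ bu']] : symbol cont_symbol 1 (- b) u.
    by apply: symbol_le us; rewrite double_gt0.
  have fd r : 0 < r -> has_deriv f r ((p + 1) * `|u r| `^ p * derive1 u r).
    move=> r0.
    exact: (has_deriv_comp (conj (du r r0) erefl) (has_deriv_signed_power (u r) p0)).
  have lapd r : 0 < r -> has_deriv (laplacian_iter alpha m u) r
      ((-1) ^+ m * ((p + 1) * `|u r| `^ p * derive1 u r)).
    by move=> r0; apply: (has_deriv_pos r0 lapE); apply: has_derivZ; exact: fd.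
  split; first by move=> r /lapd[].
  split; first by apply: pow_bounded_ext lapE _; apply: pow_boundedZ; case: fs.
  apply: (@pow_bounded_ext _ _
    (fun r => (-1) ^+ m * ((p + 1) * (`|u r| `^ p * derive1 u r)))).
    by move=> r /lapd[_ ->]; rewrite -[(p + 1) * _ * _]mulrA.
  do 2 apply: pow_boundedZ.
  have [_ bu] := uc.
  have := pow_boundedM (pow_bounded_norm_powR (ltW p0) bu) bu'.
  by rewrite mulNr /b (mul_crit_exp hcrit) -/b m2E; congr pow_bounded; ring.
- move=> j r jm r0; rewrite opp_lap ?(ltnW jm)// -(subnSK jm).
  have lt1 : (m - j.+1 < m)%N by rewrite ltn_subrL/= hm.
  rewrite (iter_radial_inv_integral (k := 0) g1 g2 fs lt1 r0).
  apply: eq_integral => t; rewrite inE => /(itv_oy_pos r0) t0; congr (_ * _)%E.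
  apply: eq_integral => s; rewrite inE => sI.
  have /andP[s0 _] : 0 < s < t by move: sI; rewrite /= in_itv.
  by rewrite opp_lap.
Qed.
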